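(* Let $R$ and $H$ be two Leibniz conformal algebras. Then all extensions of $R$ by $H$ are classified by $H^2_{nab}(R,H)$; that is, the equivalence classes of extensions of $R$ by $H$ are in bijection with $H^2_{nab}(R,H)$. The bijection sends the class of an extension $0\to H\to E\xrightarrow{p}R\to 0$ to the class of the cocycle $(l,r,\chi)$ given, for a section $s:R\to E$, by $l(a)_\lambda(h)=[s(a)_\lambda h]$, $r(a)_\lambda(h)=[h_{-\partial-\lambda}s(a)]$, $\chi_\lambda(a,b)=[s(a)_\lambda s(b)]-s([a_\lambda b])$ for $a,b\in R$, $h\in H$ (this class does not depend on $s$).
   Context: All vector spaces are over $\mathbb C$ and all $\mathbb C[\partial]$-modules are finitely generated. A Leibniz conformal algebra is a $\mathbb C[\partial]$-module $R$ with a $\mathbb C$-bilinear $\lambda$-bracket $R\times R\to R[\lambda]$, $(a,b)\mapsto[a_\lambda b]$, such that $[(\partial a)_\lambda b]=-\lambda[a_\lambda b]$, $[a_\lambda\partial b]=(\partial+\lambda)[a_\lambda b]$ and $[a_\lambda[b_\mu c]]=[[a_\lambda b]_{\lambda+\mu}c]+[b_\mu[a_\lambda c]]$. Homomorphisms are $\mathbb C[\partial]$-linear maps preserving $\lambda$-brackets. Brackets and maps are extended linearly to polynomials in the formal variables; for $x(\lambda)=\sum_k\lambda^kx_k$, $x(-\partial-\mu)$ means $\sum_k(-\partial-\mu)^kx_k$. An extension of $R$ by $H$ is a short exact sequence $0\to H\to E\xrightarrow{p}R\to0$ of Leibniz conformal algebras ($H$ is identified with its image in $E$). A section is a $\mathbb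 C[\partial]$-module homomorphism $s:R\to E$ with $p\circ s=\mathrm{id}_R$. Two extensions $E,E'$ are equivalent if there is a homomorphism of Leibniz conformal algebras $\varphi:E\to E'$ commuting with the inclusions of $H$ and the projections to $R$ (identity on $H$ and on $R$). A conformal linear map $d:H\to H$ is a $\mathbb C$-linear map $d_\lambda:H\to H[\lambda]$ with $d_\lambda(\partial v)=(\partial+\lambda)d_\lambda(v)$; these form a $\mathbb C[\partial]$-module via $(\partial d)_\lambda=-\lambda d_\lambda$. $\mathrm{CDer}^L(H)$ is the set of conformal linear maps with $d_\lambda([u_\mu v])=[u_\mu d_\lambda(v)]+[d_\lambda(u)_{\lambda+\mu}v]$; $\mathrm{CDer}^R(H)$ is the set of those with $d_\lambda([u_\mu v])=[u_\mu d_\lambda(v)]-[v_{-\partial-\lambda-\mu}d_\lambda(u)]$. A conformal bilinear map $\chi:R\times R\to H[\lambda]$ is a $\mathbb C$-bilinear map with $\chi_\lambda(\partial a,b)=-\lambda\chi_\lambda(a,b)$, $\chi_\lambda(a,\partial b)=(\partial+\lambda)\chi_\lambda(a,b)$. A non-abelian $2$-cocycle on $R$ with values in $H$ is a triple $(l,r,\chi)$ with $\chi:R\times R\to H[\lambda]$ conformal bilinear and $l:R\to\mathrm{CDer}^L(H)$, $r:R\to\mathrm{CDer}^R(H)$ $\mathbb C[\partial]$-module homomorphisms such that for all $a,b,c\in R$, $h,h_1,h_2\in H$: (i) $[(l(a)_\lambda h_1+r(a)_\lambda h_1)_{\lambda+\mu}h_2]=0$ and $r(a)_\lambda(r(b)_\mu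 h+l(b)_\mu h)=0$; (ii) $l(a)_\lambda(l(b)_\mu h)-l(b)_\mu(l(a)_\lambda h)-l([a_\lambda b])_{\lambda+\mu}h=[\chi_\lambda(a,b)_{\lambda+\mu}h]$; (iii) $l(a)_\lambda(r(b)_\mu h)-r(b)_\mu(l(a)_\lambda h)-r([a_\lambda b])_{\lambda+\mu}h=[h_{-\partial-\lambda-\mu}\chi_\lambda(a,b)]$; (iv) $\chi_\lambda(a,[b_\mu c])-\chi_\mu(b,[a_\lambda c])-\chi_{\lambda+\mu}([a_\lambda b],c)+l(a)_\lambda\chi_\mu(b,c)-l(b)_\mu\chi_\lambda(a,c)-r(c)_{-\partial-\lambda-\mu}\chi_\lambda(a,b)=0$. The set of these is $Z^2_{nab}(R,H)$. Two cocycles $(l,r,\chi)$, $(l',r',\chi')$ are equivalent if there is a $\mathbb C[\partial]$-module homomorphism $\beta:R\to H$ with $l'(a)_\lambda h-l(a)_\lambda h=[\beta(a)_\lambda h]$, $r'(a)_\lambda h-r(a)_\lambda h=[h_{-\partial-\lambda}\beta(a)]$ and $\chi'_\lambda(a,b)=\chi_\lambda(a,b)+l(a)_\lambda\beta(b)+r(b)_{-\partial-\lambda}\beta(a)-\beta([a_\lambda b])+[\beta(a)_\lambda\beta(b)]$. $H^2_{nab}(R,H)$ is the quotient of $Z^2_{nab}(R,H)$ by this equivalence relation.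
   Formalization: ''All extensions'' is read as all extensions admitting a section (a C[∂]-module splitting); others, such as 0→C[∂]→C[∂]→C→0 (multiplication by ∂, zero brackets), have no section, so the stated map is undefined on them; if R is free nothing is excluded. *)

(* Defs.v *)
From HB Require Import structures.
From mathcomp Require Import all_boot all_order all_algebra.
From mathcomp Require Import finmap.
From mathcomp Require Import monalg.

Set Implicit Arguments.
Unset Strict Implicit.
Unset Printing Implicit Defensive.

Import GRing.Theory.
Local Open Scope ring_scope.

(* A K[∂]-module is an lmodType over {poly K}: ∂ acts as 'X, and the scalar
   c : K acts as c%:P. *)

(* Polynomials with coefficients in V; the exponents are the elements of J:
   J = nat gives V[λ], and J = nat * nat gives V[λ,μ]. *)
Definition vpoly (K : fieldType) (J : nmodType) (V : lmodType {poly K}) : Type :=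
  {malg V[J]}.

HB.instance Definition _ (K : fieldType) (J : nmodType) (V : lmodType {poly K}) :=
  GRing.Zmodule.on (vpoly J V).

Definition map_coef (K : fieldType) (J : nmodType) (V W : lmodType {poly K})
    (f : V -> W) (x : vpoly J V) : vpoly J W :=
  \sum_(k <- msupp x) << f x@_k *g k >>.

Lemma mcoeff_map_coef (K : fieldType) (J : nmodType) (V W : lmodType {poly K})
    (f : V -> W) (x : vpoly J V) (k : J) :
  f 0 = 0 -> (map_coef f x)@_k = f x@_k.
Proof.
move=> f0; rewrite /map_coef raddf_sum /=.
case: (msuppP x k) => kx.
  rewrite (big_fsetD1 k) //= mcoeffUU big1_fset ?addr0 // => j.
  by rewrite in_fsetD1 mcoeffU; case: eqP.
rewrite f0 big1_fset // => j jx _.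
by rewrite mcoeffU; case: eqP kx jx => // -> /negPf ->.
Qed.

Definition vpoly_scale (K : fieldType) (J : nmodType) (V : lmodType {poly K})
    (p : {poly K}) (x : vpoly J V) : vpoly J V :=
  map_coef (fun v => p *: v) x.

Lemma vpoly_scaleA (K : fieldType) (J : nmodType) (V : lmodType {poly K})
    (p q : {poly K}) (x : vpoly J V) :
  vpoly_scale p (vpoly_scale q x) = vpoly_scale (p * q) x.
Proof.
by apply/malgP => k; rewrite !mcoeff_map_coef ?scaler0 // scalerA.
Qed.

Lemma vpoly_scale1 (K : fieldType) (J : nmodType) (V : lmodType {poly K}) :
  left_id 1 (@vpoly_scale K J V).
Proof.
by move=> x; apply/malgP => k; rewrite mcoeff_map_coef ?scaler0 // scale1r.
Qed.

Lemma vpoly_scaleDr (K : fieldType) (J : nmodType) (V : lmodType {poly K}) :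
  right_distributive (@vpoly_scale K J V) +%R.
Proof.
move=> p x y; apply/malgP => k.
by rewrite [RHS]mcoeffD !mcoeff_map_coef ?scaler0 // mcoeffD scalerDr.
Qed.

Lemma vpoly_scaleDl (K : fieldType) (J : nmodType) (V : lmodType {poly K})
    (x : vpoly J V) :
  {morph (@vpoly_scale K J V)^~ x : p q / p + q}.
Proof.
move=> p q; apply/malgP => k.
by rewrite [RHS]mcoeffD !mcoeff_map_coef ?scaler0 // scalerDl.
Qed.

HB.instance Definition _ (K : fieldType) (J : nmodType) (V : lmodType {poly K}) :=
  GRing.Zmodule_isLmodule.Build {poly K} (vpoly J V)
    (@vpoly_scaleA K J V) (@vpoly_scale1 K J V)
    (@vpoly_scaleDr K J V) (@vpoly_scaleDl K J V).

(* Multiplication by the monomial of exponent m. *)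
Definition vshift (K : fieldType) (J : nmodType) (V : lmodType {poly K})
    (m : J) (x : vpoly J V) : vpoly J V :=
  \sum_(k <- msupp x) << x@_k *g (m + k) >>.

Definition cst (K : fieldType) (J : nmodType) (V : lmodType {poly K})
    (v : V) : vpoly J V := << v *g 0 >>.
Arguments cst {K} J {V} v.

(* ∂, the λ of V[λ], and the λ and μ of V[λ,μ], as operators. *)
Definition der (K : fieldType) (J : nmodType) (V : lmodType {poly K})
    (x : vpoly J V) : vpoly J V := 'X *: x.
Definition lam1 (K : fieldType) (V : lmodType {poly K}) :
    vpoly nat V -> vpoly nat V := vshift 1%N.
Definition lam (K : fieldType) (V : lmodType {poly K}) :
    vpoly (nat * nat)%type V -> vpoly (nat * nat)%type V := vshift (1%N, 0%N).
Definition mu (K : fieldType) (V : lmodType {poly K}) :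
    vpoly (nat * nat)%type V -> vpoly (nat * nat)%type V := vshift (0%N, 1%N).
Arguments der {K J V} x.
Arguments lam1 {K V} _.
Arguments lam {K V} _.
Arguments mu {K V} _.

(* x(θ) = \sum_k θ^k x_k for x in V[λ] and an operator θ, such as -∂-λ-μ. *)
Definition subst (K : fieldType) (J : nmodType) (V : lmodType {poly K})
    (theta : vpoly J V -> vpoly J V) (x : vpoly nat V) : vpoly J V :=
  \sum_(k <- msupp x) iter k theta (cst J x@_k).

(* d_θ(x), for d : V -> W[λ] extended linearly to polynomials x in the formal
   variables. *)
Definition ext1 (K : fieldType) (J : nmodType) (V W : lmodType {poly K})
    (d : V -> vpoly nat W) (theta : vpoly J W -> vpoly J W)
    (x : vpoly J V) : vpoly J W :=
  \sum_(m <- msupp x) vshift m (subst theta (d x@_m)).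

(* B_θ(x, y), for B : U * V -> W[λ] extended bilinearly to polynomials x and y
   in the formal variables. The operator θ is applied to the values of B, so a ∂
   in θ is that of W, outside the whole bracket. *)
Definition ext2 (K : fieldType) (J : nmodType) (U V W : lmodType {poly K})
    (B : U -> V -> vpoly nat W) (theta : vpoly J W -> vpoly J W)
    (x : vpoly J U) (y : vpoly J V) : vpoly J W :=
  \sum_(m <- msupp x) \sum_(n <- msupp y)
    vshift (m + n) (subst theta (B x@_m y@_n)).

Notation "v %:V" := (cst (nat * nat)%type v)
  (at level 2, left associativity, format "v %:V").
Notation "B @_[ theta ]" := (ext2 B theta)
  (at level 3, left associativity, format "B @_[ theta ]").
Notation "d @1_[ theta ]" := (ext1 d theta)
  (at level 3, left associativity, format "d @1_[ theta ]").

Definition Klinear (K : fieldType) (V W : lmodType {poly K}) (f : V -> W) : Prop :=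
  forall (c : K) (u v : V), f (c%:P *: u + v) = c%:P *: f u + f v.

Definition finitely_generated (A : pzRingType) (V : lmodType A) : Prop :=
  exists (n : nat) (g : 'I_n -> V),
    forall v, exists c : 'I_n -> A, v = \sum_i c i *: g i.

Definition conformal_bilinear (K : fieldType) (U V W : lmodType {poly K})
    (B : U -> V -> vpoly nat W) : Prop :=
  [/\ forall v, Klinear (fun u => B u v),
      forall u, Klinear (B u),
      forall u v, B ('X *: u) v = - lam1 (B u v)
    & forall u v, B u ('X *: v) = (der \+ lam1) (B u v)].

Definition leibniz_identity (K : fieldType) (V : lmodType {poly K})
    (B : V -> V -> vpoly nat V) : Prop :=
  forall a b c : V,
    B@_[lam] a%:V (B@_[mu] b%:V c%:V)
    = B@_[lam \+ mu] (B@_[lam] a%:V b%:V) c%:V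
      + B@_[mu] b%:V (B@_[lam] a%:V c%:V).

Record leibniz_conformal (K : fieldType) := LeibnizConformal {
  lc_sort :> lmodType {poly K};
  br : lc_sort -> lc_sort -> vpoly nat lc_sort;
  lc_fg : finitely_generated lc_sort;
  br_bilinear : conformal_bilinear br;
  br_leibniz : leibniz_identity br
}.
Arguments br {K l} _ _.

(* Homomorphisms are K[∂]-linear maps, i.e. {linear L -> M}, with: *)
Definition preserves_bracket (K : fieldType) (L M : leibniz_conformal K)
    (f : L -> M) : Prop :=
  forall a b : L, map_coef f (br a b) = br (f a) (f b).

Record extension (K : fieldType) (R H : leibniz_conformal K) := Extension {
  ext_sort :> leibniz_conformal K;
  ext_inj : {linear H -> ext_sort};
  ext_proj : {linear ext_sort -> R};
  ext_inj_hom : preserves_bracket ext_inj;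
  ext_proj_hom : preserves_bracket ext_proj;
  ext_inj_inj : injective ext_inj;
  ext_proj_surj : forall a : R, exists x, ext_proj x = a;
  ext_exact : forall x, ext_proj x = 0 <-> exists h, x = ext_inj h
}.

Definition is_section (K : fieldType) (R H : leibniz_conformal K)
    (E : extension R H) (s : {linear R -> E}) : Prop :=
  forall a : R, ext_proj E (s a) = a.

(* When R has ∂-torsion an extension may have no section: with zero brackets,
   0 -> K[∂] -∂-> K[∂] -> K -> 0 has none. Such an extension has no associated
   cocycle, so the classification is about the extensions having a section,
   which are all of them when R is free (free_has_section below). *)
Record split_extension (K : fieldType) (R H : leibniz_conformal K) :=
  SplitExtension {
  split_sort :> extension R H;
  split_section : exists s : {linear R -> split_sort}, is_section s
}.

Definition free_module (A : pzRingType) (V : lmodType A) : Prop :=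
  exists (n : nat) (g : 'I_n -> V), forall v, exists! c : {ffun 'I_n -> A},
    v = \sum_i c i *: g i.

Lemma free_has_section (K : fieldType) (R H : leibniz_conformal K)
    (E : extension R H) :
  free_module R -> exists s : {linear R -> E}, is_section s.
Proof.
case=> n [g gP].
have ex_e i : exists x : E, ext_proj E x == g i.
  by have [x xg] := ext_proj_surj E (g i); exists x; apply/eqP.
have ex_c (v : R) : exists c : {ffun 'I_n -> {poly K}}, v == \sum_i c i *: g i.
  by have [c [cv _]] := gP v; exists c; apply/eqP.
pose c v := xchoose (ex_c v).
have cP v : v = \sum_i c v i *: g i by exact/eqP/(xchooseP (ex_c v)).
have c_uniq v (d : {ffun 'I_n -> {poly K}}) : v = \sum_i d i *: g i -> c v = d.
  by move=> dP; have [d' [_ d'u]] := gP v; rewrite -(d'u _ (cP v)) -(d'u _ dP).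
pose s (v : R) : E := \sum_i c v i *: xchoose (ex_e i).
have s_lin : linear s.
  move=> a u v.
  have -> : s (a *: u + v) = \sum_i (a * c u i + c v i) *: xchoose (ex_e i).
    rewrite /s (c_uniq _ [ffun i => a * c u i + c v i]).
      by apply: eq_bigr => i _; rewrite ffunE.
    rewrite {1}(cP u) {1}(cP v) scaler_sumr -big_split.
    by apply: eq_bigr => i _; rewrite ffunE scalerDl scalerA.
  rewrite /s scaler_sumr -big_split.
  by apply: eq_bigr => i _; rewrite scalerDl scalerA.
pose sL := GRing.isLinear.Build _ _ _ _ s s_lin.
pose S : {linear R -> E} := HB.pack s sL.
exists S => v; rewrite [LHS]linear_sum [RHS]cP /=.
by apply: eq_bigr => i _; rewrite linearZ (eqP (xchooseP (ex_e i))).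
Qed.

Definition equiv_extension (K : fieldType) (R H : leibniz_conformal K)
    (E E' : split_extension R H) : Prop :=
  exists phi : {linear E -> E'},
    [/\ preserves_bracket phi,
        forall h, phi (ext_inj E h) = ext_inj E' h
      & forall x, ext_proj E' (phi x) = ext_proj E x].

Definition conformal_linear (K : fieldType) (V W : lmodType {poly K})
    (d : V -> vpoly nat W) : Prop :=
  Klinear d /\ forall v, d ('X *: v) = (der \+ lam1) (d v).

Definition CDerL (K : fieldType) (H : leibniz_conformal K)
    (d : H -> vpoly nat H) : Prop :=
  conformal_linear d /\
  forall u v : H,
    d@1_[lam] (br@_[mu] u%:V v%:V)
    = br@_[mu] u%:V (d@1_[lam] v%:V)
      + br@_[lam \+ mu] (d@1_[lam] u%:V) v%:V.

Definition CDerR (K : fieldType) (H : leibniz_conformal K)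
    (d : H -> vpoly nat H) : Prop :=
  conformal_linear d /\
  forall u v : H,
    d@1_[lam] (br@_[mu] u%:V v%:V)
    = br@_[mu] u%:V (d@1_[lam] v%:V)
      - br@_[\- (der \+ lam \+ mu)] v%:V (d@1_[lam] u%:V).

(* K[∂]-linearity of l : R -> Hom(V, W[λ]) for (∂ d)_λ = - λ d_λ. *)
Definition conformal_hom (K : fieldType) (R V W : lmodType {poly K})
    (l : R -> V -> vpoly nat W) : Prop :=
  (forall v, Klinear (fun a => l a v)) /\
  forall a v, l ('X *: a) v = - lam1 (l a v).

Record nab_cocycle (K : fieldType) (R H : leibniz_conformal K) := NabCocycle {
  cl : R -> H -> vpoly nat H;
  cr : R -> H -> vpoly nat H;
  cchi : R -> R -> vpoly nat H;
  cchi_bilinear : conformal_bilinear cchi;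
  cl_CDerL : forall a, CDerL (cl a);
  cl_hom : conformal_hom cl;
  cr_CDerR : forall a, CDerR (cr a);
  cr_hom : conformal_hom cr;
  nab_i1 : forall (a : R) (h1 h2 : H),
    br@_[lam \+ mu] (cl@_[lam] a%:V h1%:V + cr@_[lam] a%:V h1%:V) h2%:V = 0;
  nab_i2 : forall (a b : R) (h : H),
    cr@_[lam] a%:V (cr@_[mu] b%:V h%:V + cl@_[mu] b%:V h%:V) = 0;
  nab_ii : forall (a b : R) (h : H),
    cl@_[lam] a%:V (cl@_[mu] b%:V h%:V)
    - cl@_[mu] b%:V (cl@_[lam] a%:V h%:V)
    - cl@_[lam \+ mu] (br@_[lam] a%:V b%:V) h%:V
    = br@_[lam \+ mu] (cchi@_[lam] a%:V b%:V) h%:V;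
  nab_iii : forall (a b : R) (h : H),
    cl@_[lam] a%:V (cr@_[mu] b%:V h%:V)
    - cr@_[mu] b%:V (cl@_[lam] a%:V h%:V)
    - cr@_[lam \+ mu] (br@_[lam] a%:V b%:V) h%:V
    = br@_[\- (der \+ lam \+ mu)] h%:V (cchi@_[lam] a%:V b%:V);
  nab_iv : forall a b c : R,
    cchi@_[lam] a%:V (br@_[mu] b%:V c%:V)
    - cchi@_[mu] b%:V (br@_[lam] a%:V c%:V)
    - cchi@_[lam \+ mu] (br@_[lam] a%:V b%:V) c%:V
    + cl@_[lam] a%:V (cchi@_[mu] b%:V c%:V)
    - cl@_[mu] b%:V (cchi@_[lam] a%:V c%:V)
    - cr@_[\- (der \+ lam \+ mu)] c%:V (cchi@_[lam] a%:V b%:V) = 0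
}.

Definition equiv_cocycle (K : fieldType) (R H : leibniz_conformal K)
    (z z' : nab_cocycle R H) : Prop :=
  exists beta : {linear R -> H},
    [/\ forall a h, cl z' a h - cl z a h = br (beta a) h,
        forall a h,
          cr z' a h - cr z a h = subst (\- (der \+ lam1)) (br h (beta a))
      & forall a b,
          cchi z' a b = cchi z a b + cl z a (beta b)
            + subst (\- (der \+ lam1)) (cr z b (beta a))
            - map_coef beta (br a b) + br (beta a) (beta b)].

(* The quotient of T by an equivalence relation, as the set of its classes. *)
Definition classes (T : Type) (e : T -> T -> Prop) :=
  {C : T -> Prop | exists x, C = e x}.

Definition class_of (T : Type) (e : T -> T -> Prop) (x : T) : classes e :=
  exist _ (e x) (ex_intro _ x erefl).

Definition H2nab (K : fieldType) (R H : leibniz_conformal K) :=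
  classes (@equiv_cocycle K R H).

Definition extension_classes (K : fieldType) (R H : leibniz_conformal K) :=
  classes (@equiv_extension K R H).

(* Equalities in E[λ], where H[λ] is embedded by the inclusion of H in E. *)
Definition cocycle_of_section (K : fieldType) (R H : leibniz_conformal K)
    (E : extension R H) (s : {linear R -> E}) (z : nab_cocycle R H) : Prop :=
  [/\ forall a h, map_coef (ext_inj E) (cl z a h) = br (s a) (ext_inj E h),
      forall a h, map_coef (ext_inj E) (cr z a h)
                  = subst (\- (der \+ lam1)) (br (ext_inj E h) (s a))
    & forall a b, map_coef (ext_inj E) (cchi z a b)
                  = br (s a) (s b) - map_coef s (br a b)].

(* Main.v *)
(* The cocycle conditions are the Leibniz identity of the extension, read through
   a section. For a conformal bilinear bracket on a C[∂]-module E split as R + H,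
   the defect of the Leibniz identity is additive in each argument, so it vanishes
   as soon as it does on arguments taken from R or H. After a substitution of the
   formal variables, which is needed because r(a) is the bracket with a on the
   right and is evaluated at -∂-λ, the image in E of each cocycle condition is the
   defect on one of these eight types of triples: (i) gives HRH and HRR, (ii) RRH,
   (iii) RHR, (iv) RRR, CDer^L gives RHH and CDer^R gives HHR; HHH is the Leibniz
   identity of H. The substitutions being invertible, an extension with a section
   yields a cocycle, and a cocycle makes R * H an extension. A change of section
   and an equivalence of extensions are both given by a map β : R -> H. *)
From HB Require Import structures.
Require Import Defs.
From mathcomp Require Import all_boot all_order all_algebra.
From mathcomp Require Import finmap monalg.
From mathcomp Require Import boolp reals complex.

Set Implicit Arguments.
Unset Strict Implicit.
Unset Printing Implicit Defensive.

Import GRing.Theory.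
Local Open Scope ring_scope.

(** * Additive maps and polynomials *)

(** In a triple of arguments one carries λ, one carries μ and the last, tacitly, ν = -∂-λ-μ. A
    cocycle condition fixes which argument carries which variable, whereas the defect gives λ, μ, ν
    to its first, second and third argument; the substitution matching the two is therefore a
    permutation of λ, μ, ν. The obstacle is that ∂ itself changes when it crosses a bracket: under a
    bracket taken at the form f, ∂ reads -f in the left argument and ∂ + f in the right one.
    Everything substituted is an integer linear form in ∂, λ, μ, so forms are kept as triples of
    integers and the side conditions between concrete forms hold by evaluation. Condition (i) never
    meets a single defect but a sum of two, HRH with RHH and HRR with RHR, which dictates the order
    in which the defects are shown to vanish. The laws of an equivalence relation are checked only
    for extensions, where maps can be composed and inverted, and are carried to cocycles through the
    products R * H. *)

Definition addm (V W : zmodType) (f : V -> W) : Prop := {morph f : x y / x + y}.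

Section AdditiveMaps.
Variables (V W : zmodType) (f : V -> W).
Hypothesis fD : addm f.

Lemma addm0 : f 0 = 0.
Proof. by apply: (addrI (f 0)); rewrite -fD !addr0. Qed.

Lemma addmN : {morph f : x / - x}.
Proof. by move=> x; apply: (addrI (f x)); rewrite -fD !subrr addm0. Qed.

Lemma addmB : {morph f : x y / x - y}.
Proof. by move=> x y; rewrite fD addmN. Qed.

Lemma addm_sum (I : Type) (r : seq I) (P : pred I) (F : I -> V) :
  f (\sum_(i <- r | P i) F i) = \sum_(i <- r | P i) f (F i).
Proof. exact: (big_morph f fD addm0). Qed.

Lemma addmMz n : {morph f : x / x *~ n}.
Proof.
have fMn k x : f (x *+ k) = f x *+ k.
  by elim: k => [|k IH]; rewrite ?mulr0n ?addm0 // !mulrS fD IH.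
by case: n => n x; [exact: fMn | rewrite !NegzE !mulrNz addmN -!pmulrn fMn].
Qed.

End AdditiveMaps.

Lemma addm_comp (U V W : zmodType) (g : V -> W) (f : U -> V) :
  addm g -> addm f -> addm (g \o f).
Proof. by move=> gD fD x y /=; rewrite fD gD. Qed.

Lemma addm_linear (A : pzRingType) (V W : lmodType A) (f : {linear V -> W}) :
  addm f.
Proof. exact: linearD. Qed.

Lemma addm_iter (V : zmodType) (f : V -> V) k : addm f -> addm (iter k f).
Proof. by move=> fD x y; elim: k => //= k ->; rewrite fD. Qed.

Section LinearExtension.
Variables (K : fieldType) (J : nmodType) (V : lmodType {poly K}) (A : zmodType).
Variable F : J -> V -> A.
Hypothesis FD : forall k, addm (F k).

(** The common shape of [map_coef], [vshift], [subst] and [subst2]: a map prescribed on each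
    monomial. They unfold to it, so that [msumD] and [msumU] apply to them up to conversion. *)
Definition msum (x : vpoly J V) : A := \sum_(k <- msupp x) F k x@_k.

(** Terms off the support vanish by additivity of [F k]. This lets x, y and x + y be summed over one
    common set. *)
Lemma msum_wide (d : {fset J}) (x : vpoly J V) :
  (msupp x `<=` d)%fset -> msum x = \sum_(k <- d) F k x@_k.
Proof.
move=> xd; rewrite /msum; apply: (big_fset_incl _ xd) => k _ kx.
by rewrite mcoeff_outdom // addm0.
Qed.

Lemma msumD : addm msum.
Proof.
move=> x y.
have xyd := msuppD_le x y.
rewrite (msum_wide xyd) (msum_wide (fsubsetUl (msupp x) (msupp y))).
rewrite (msum_wide (fsubsetUr (msupp x) (msupp y))) -big_split /=.
by apply: eq_bigr => k _; rewrite mcoeffD FD.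
Qed.

Lemma msumU k v : msum << v *g k >> = F k v.
Proof.
by rewrite (msum_wide (@msuppU_le _ _ k v)) big_seq_fset1 mcoeffUU.
Qed.

End LinearExtension.

Section Calculus.
Variables (K : fieldType).
Implicit Types (J : nmodType) (U V W : lmodType {poly K}).

Lemma vpoly_ext J V (A : zmodType) (f g : vpoly J V -> A) :
  addm f -> addm g -> (forall k v, f << v *g k >> = g << v *g k >>) -> f =1 g.
Proof.
move=> fD gD fg x; rewrite (monalgE x).
rewrite -[LHS]/(f (\sum_(k <- msupp x) << x@_k *g k >>)).
rewrite -[RHS]/(g (\sum_(k <- msupp x) << x@_k *g k >>)).
by rewrite (addm_sum fD) (addm_sum gD); apply: eq_bigr => k _; apply: fg.
Qed.

Lemma vshiftD J V (m : J) : addm (@vshift K J V m).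
Proof.
by apply: (@msumD _ _ _ _ (fun k v => << v *g (m + k) >>)) => k u v; apply: monalgUD.
Qed.

Lemma vshiftU J V (m k : J) (v : V) : vshift m << v *g k >> = << v *g (m + k) >>.
Proof.
by apply: (@msumU _ _ _ _ (fun k v => << v *g (m + k) >>)) => j u w; apply: monalgUD.
Qed.

Lemma vshiftA J V (m n : J) (x : vpoly J V) :
  vshift m (vshift n x) = vshift (m + n) x.
Proof.
move: x; apply: vpoly_ext; [|exact: vshiftD|by move=> k v; rewrite !vshiftU addrA].
by apply: (addm_comp (@vshiftD _ _ _) (@vshiftD _ _ _)).
Qed.

Lemma vshift0 J V (x : vpoly J V) : vshift 0 x = x.
Proof.
by move: x; apply: vpoly_ext => [||k v]; [exact: vshiftD|by []|rewrite vshiftU add0r].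
Qed.

Lemma cstD J V : addm (@cst K J V).
Proof. by move=> u v; apply: monalgUD. Qed.

Lemma vshift_cst J V (m : J) (v : V) : vshift m (cst J v) = << v *g m >>.
Proof. by rewrite vshiftU addr0. Qed.

Lemma derD J V : addm (@der K J V).
Proof. by move=> x y; rewrite /der scalerDr. Qed.

Lemma map_coefD J V W (f : V -> W) : addm f -> addm (@map_coef K J V W f).
Proof.
move=> fD; apply: (@msumD _ _ _ _ (fun k v => << f v *g k >>)) => k u v /=.
by rewrite fD monalgUD.
Qed.

Lemma map_coefU J V W (f : V -> W) (k : J) v : addm f ->
  map_coef f << v *g k >> = << f v *g k >>.
Proof.
move=> fD; apply: (@msumU _ _ _ _ (fun k v => << f v *g k >>)) => j u w /=.
by rewrite fD monalgUD.
Qed.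

Lemma map_coef_cst J V W (f : V -> W) v : addm f -> map_coef f (cst J v) = cst J (f v).
Proof. exact: map_coefU. Qed.

Lemma map_coef_shift J V W (f : V -> W) (m : J) x : addm f ->
  map_coef f (vshift m x) = vshift m (map_coef f x).
Proof.
move=> fD; move: x; apply: vpoly_ext => [||k v].
- exact: addm_comp (map_coefD fD) (@vshiftD _ _ _).
- exact: addm_comp (@vshiftD _ _ _) (map_coefD fD).
- by rewrite vshiftU !map_coefU // vshiftU.
Qed.

Lemma derU J V (k : J) (v : V) : der << v *g k >> = << 'X *: v *g k >> :> vpoly J V.
Proof. by apply: map_coefU => x y; rewrite scalerDr. Qed.

Lemma der_cst J V (v : V) : der (cst J v) = cst J ('X *: v).
Proof. exact: derU. Qed.

Lemma der_shift J V (m : J) (x : vpoly J V) : der (vshift m x) = vshift m (der x).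
Proof. by apply: map_coef_shift => u v; rewrite scalerDr. Qed.

Lemma map_coef_der J V W (f : {linear V -> W}) (x : vpoly J V) :
  map_coef f (der x) = der (map_coef f x).
Proof.
have fD := @addm_linear _ _ _ f.
move: x; apply: vpoly_ext => [||k v].
- exact: addm_comp (map_coefD fD) (@derD _ _).
- exact: addm_comp (@derD _ _) (map_coefD fD).
- by rewrite derU !map_coefU // derU linearZ.
Qed.

Lemma map_coef_comp J U V W (g : V -> W) (f : U -> V) (x : vpoly J U) :
  addm g -> addm f -> map_coef g (map_coef f x) = map_coef (g \o f) x.
Proof.
move=> gD fD; apply/malgP => k.
by rewrite !mcoeff_map_coef /= ?(addm0 fD) ?(addm0 gD).
Qed.

Lemma map_coef_id J V (x : vpoly J V) : map_coef id x = x.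
Proof. by apply/malgP => k; rewrite mcoeff_map_coef. Qed.

Lemma map_coef_inj J V W (f : V -> W) : addm f -> injective f ->
  injective (@map_coef K J V W f).
Proof.
move=> fD fI x y xy; apply/malgP => k; apply: fI.
by rewrite -!mcoeff_map_coef ?(addm0 fD) // xy.
Qed.

Lemma map_coef_subf J V W (f g : V -> W) (x : vpoly J V) : addm f -> addm g ->
  map_coef (fun v => f v - g v) x = map_coef f x - map_coef g x.
Proof.
move=> fD gD; apply/malgP => k; rewrite [RHS]mcoeffB !mcoeff_map_coef //.
all: by rewrite ?(addm0 fD) ?(addm0 gD) ?subr0.
Qed.

(** Constants and multiplication by λ generate V[λ]. [P] is what λ becomes under both maps; with its
    two-variable analogue this replaces inductions on exponents by one check on λ and one on
    constants. *)
Lemma lam1_ext V (A : zmodType) (P : A -> A) (f g : vpoly nat V -> A) :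
  addm f -> addm g ->
  (forall x, f (lam1 x) = P (f x)) -> (forall x, g (lam1 x) = P (g x)) ->
  (forall v, f (cst nat v) = g (cst nat v)) -> f =1 g.
Proof.
move=> fD gD fP gP fg; apply: vpoly_ext => // k v.
elim: k => [|k IH]; first exact: fg.
have -> : << v *g k.+1 >> = lam1 << v *g k >> :> vpoly nat V by rewrite /lam1 vshiftU.
by rewrite fP gP IH.
Qed.

Lemma lam_mu_ext V (A : zmodType) (P Q : A -> A) (f g : vpoly (nat * nat)%type V -> A) :
  addm f -> addm g ->
  (forall x, f (lam x) = P (f x)) -> (forall x, g (lam x) = P (g x)) ->
  (forall x, f (mu x) = Q (f x)) -> (forall x, g (mu x) = Q (g x)) ->
  (forall v, f v%:V = g v%:V) -> f =1 g.
Proof.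
move=> fD gD fP gP fQ gQ fg; apply: vpoly_ext => // -[i j] v.
elim: i => [|i IH]; last first.
  have -> : << v *g (i.+1, j) >> = lam << v *g (i, j) >> :> vpoly (nat * nat)%type V.
    by rewrite /lam vshiftU.
  by rewrite fP gP IH.
elim: j => [|j IH]; first exact: fg.
have -> : << v *g (0%N, j.+1) >> = mu << v *g (0%N, j) >> :> vpoly (nat * nat)%type V.
  by rewrite /mu vshiftU.
by rewrite fQ gQ IH.
Qed.

Section Subst.
Variables (J : nmodType) (V : lmodType {poly K}) (theta : vpoly J V -> vpoly J V).
Hypothesis thetaD : addm theta.

Let F k v := iter k theta (cst J v).
Let FD k : addm (F k).
Proof. exact: addm_comp (addm_iter k thetaD) (@cstD _ _). Qed.

Lemma substD : addm (subst theta).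
Proof. exact: (msumD FD). Qed.

Lemma substU k v : subst theta << v *g k >> = iter k theta (cst J v).
Proof. exact: (msumU FD). Qed.

Lemma subst_cst v : subst theta (cst nat v) = cst J v.
Proof. exact: substU. Qed.

Lemma subst_lam1 x : subst theta (lam1 x) = theta (subst theta x).
Proof.
move: x; apply: vpoly_ext => [||k v].
- exact: addm_comp substD (@vshiftD _ _ _).
- exact: addm_comp thetaD substD.
- by rewrite /lam1 vshiftU !substU.
Qed.

Lemma subst_der x : (forall y, theta (der y) = der (theta y)) ->
  subst theta (der x) = der (subst theta x).
Proof.
move=> tC; move: x; apply: (@lam1_ext _ _ theta) => [||x|x|v].
- exact: addm_comp substD (@derD _ _).
- exact: addm_comp (@derD _ _) substD.
- by rewrite /lam1 der_shift subst_lam1.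
- by rewrite subst_lam1 tC.
- by rewrite der_cst !subst_cst der_cst.
Qed.

End Subst.

Lemma map_subst J V W (f : V -> W) (theta : vpoly J V -> vpoly J V)
    (theta' : vpoly J W -> vpoly J W) x :
  addm f -> addm theta -> addm theta' ->
  (forall y, map_coef f (theta y) = theta' (map_coef f y)) ->
  map_coef f (subst theta x) = subst theta' (map_coef f x).
Proof.
move=> fD tD tD' ft; move: x; apply: vpoly_ext => [||k v].
- exact: addm_comp (map_coefD fD) (substD tD).
- exact: addm_comp (substD tD') (map_coefD fD).
- rewrite substU // map_coefU // substU //.
  by elim: k => [|k IH] /=; rewrite ?map_coef_cst // ft IH.
Qed.

Lemma subst_comp J V (theta theta'' : vpoly J V -> vpoly J V)
    (theta' : vpoly nat V -> vpoly nat V) x :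
  addm theta -> addm theta' -> addm theta'' ->
  (forall y, subst theta (theta' y) = theta'' (subst theta y)) ->
  subst theta (subst theta' x) = subst theta'' x.
Proof.
move=> tD tD' tD'' h; move: x; apply: (@lam1_ext _ _ theta'') => [||x|x|v].
- exact: addm_comp (substD tD) (substD tD').
- exact: substD.
- by rewrite subst_lam1 // h.
- by rewrite subst_lam1.
- by rewrite !subst_cst.
Qed.

Lemma subst_lam1_id V (x : vpoly nat V) : subst lam1 x = x.
Proof.
have lD : addm (@lam1 K V) by exact: vshiftD.
move: x; apply: (@lam1_ext _ _ lam1) => [||x|x|v] //; first exact: substD.
  exact: subst_lam1.
exact: subst_cst.
Qed.

End Calculus.

(** * Linear forms in ∂, λ, μ and their substitution *)

(* The linear form [a ∂ + b λ + c μ] with integer coefficients. *)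
Definition form : Type := (int * int * int)%type.
HB.instance Definition _ := GRing.Zmodule.on form.

Definition fder : form := (1, 0, 0).
Definition flam : form := (0, 1, 0).
Definition fmu : form := (0, 0, 1).

(** Stated in any abelian group, because the same combination is taken of operators applied to a
    polynomial ([op]) and of forms ([fsubst]). *)
Definition fcomb (A : zmodType) (f : form) (x y z : A) : A :=
  x *~ f.1.1 + y *~ f.1.2 + z *~ f.2.

Section Combination.
Variable A : zmodType.
Implicit Types (f g : form) (x y z : A).

Lemma fcombDr f x y z x' y' z' :
  fcomb f (x + x') (y + y') (z + z') = fcomb f x y z + fcomb f x' y' z'.
Proof. by rewrite /fcomb !mulrzDl [RHS]addrACA [X in _ = X + _]addrACA. Qed.

Lemma fcombDl f g x y z : fcomb (f + g) x y z = fcomb f x y z + fcomb g x y z.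
Proof. by rewrite /fcomb !mulrzDr [RHS]addrACA [X in _ = X + _]addrACA. Qed.

Lemma fcomb_der x y z : fcomb fder x y z = x.
Proof. by rewrite /fcomb /= !mulr0z !addr0. Qed.

Lemma fcomb_lam x y z : fcomb flam x y z = y.
Proof. by rewrite /fcomb /= !mulr0z addr0 add0r. Qed.

Lemma fcomb_mu x y z : fcomb fmu x y z = z.
Proof. by rewrite /fcomb /= !mulr0z !add0r. Qed.

Lemma addm_fcomb (B : zmodType) (T : A -> B) f x y z : addm T ->
  T (fcomb f x y z) = fcomb f (T x) (T y) (T z).
Proof. by move=> TD; rewrite /fcomb !TD !(addmMz TD). Qed.

End Combination.

(* The form [f] after substituting [d], [l], [m] for ∂, λ, μ. *)
Definition fsubst (d l m f : form) : form := fcomb f d l m.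

Definition biadditive (U V W : zmodType) (B : U -> V -> W) : Prop :=
  (forall v, addm (B^~ v)) /\ (forall u, addm (B u)).

Section Forms.
Variable K : fieldType.
Implicit Types (U V W : lmodType {poly K}).

Definition op V (f : form) (x : vpoly (nat * nat)%type V) : vpoly (nat * nat)%type V :=
  fcomb f (der x) (lam x) (mu x).

Lemma opD V (f : form) : addm (@op V f).
Proof. by move=> x y; rewrite /op /lam /mu derD !vshiftD fcombDr. Qed.

Lemma op_formD V (f g : form) (x : vpoly (nat * nat)%type V) :
  op (f + g) x = op f x + op g x.
Proof. exact: fcombDl. Qed.

Lemma op_formN V (f : form) (x : vpoly (nat * nat)%type V) : op (- f) x = - op f x.
Proof. by apply: (addmN (f := fun f => op f x)) => g h; apply: op_formD. Qed.

Lemma op_fder V : @op V fder = der.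
Proof. apply/funext => x; exact: fcomb_der. Qed.

Lemma op_flam V : @op V flam = lam.
Proof. by apply/funext => x; exact: fcomb_lam. Qed.

Lemma op_fmu V : @op V fmu = mu.
Proof. by apply/funext => x; exact: fcomb_mu. Qed.

Lemma op_fadd V (f g : form) : @op V (f + g) = op f \+ op g.
Proof. by apply/funext => x; exact: op_formD. Qed.

Lemma op_fopp V (f : form) : @op V (- f) = \- op f.
Proof. by apply/funext => x; exact: op_formN. Qed.

Definition opE := (op_fopp, op_fadd, op_fder, op_flam, op_fmu).

(** A form is an integer combination of ∂, λ, μ, so an additive map is known on all [op f] once it
    is known how it turns these three. It is applied to substitutions and to a bracket seen as a map
    of either argument. *)
Lemma op_transport U V (T : vpoly (nat * nat)%type U -> vpoly (nat * nat)%type V)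
    (d l m f : form) : addm T ->
  (forall x, T (der x) = op d (T x)) -> (forall x, T (lam x) = op l (T x)) ->
  (forall x, T (mu x) = op m (T x)) ->
  forall x, T (op f x) = op (fsubst d l m f) (T x).
Proof.
move=> TD Td Tl Tm x.
rewrite [LHS](addm_fcomb _ _ _ _ TD) Td Tl Tm.
by symmetry; apply: (addm_fcomb (T := fun g => op g (T x))) => g h; exact: op_formD.
Qed.

Lemma fsubst_id f : fsubst fder flam fmu f = f.
Proof.
have fsub_proj (A : zmodType) (T : form -> A) : addm T ->
    T (fsubst fder flam fmu f) = fcomb f (T fder) (T flam) (T fmu).
  by move=> TD; rewrite [LHS](addm_fcomb _ _ _ _ TD).
rewrite [LHS]surjective_pairing [X in (X, _)]surjective_pairing.
rewrite (fsub_proj _ (fun g => g.1.1)) // (fsub_proj _ (fun g => g.1.2)) //.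
rewrite (fsub_proj _ (fun g => g.2)) // /fcomb /= !mul0rz !intz !addr0 !add0r.
by case: f {fsub_proj} => [[]].
Qed.

Lemma op_commute U V (T : vpoly (nat * nat)%type U -> vpoly (nat * nat)%type V) f :
  addm T -> {morph T : x / der x} -> {morph T : x / lam x} -> {morph T : x / mu x} ->
  {morph T : x / op f x}.
Proof.
move=> TD Td Tl Tm x; rewrite (@op_transport _ _ T fder flam fmu) ?fsubst_id //.
all: by move=> {}x; rewrite ?op_fder ?op_flam ?op_fmu.
Qed.

Lemma op_shift V f m : {morph @op V f : x / vshift m x}.
Proof.
move=> x; symmetry; apply: (op_commute (T := vshift m)) => [|{}x|{}x|{}x].
- exact: vshiftD.
- by rewrite der_shift.
- by rewrite /lam !vshiftA addrC.
- by rewrite /mu !vshiftA addrC.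
Qed.

Lemma op_der V f : {morph @op V f : x / der x}.
Proof.
move=> x; rewrite -{1}op_fder -op_commute ?op_fder //.
all: by move=> *; rewrite ?derD // /lam /mu ?der_shift.
Qed.

Lemma map_coef_op V W (g : {linear V -> W}) f (x : vpoly (nat * nat)%type V) :
  map_coef g (op f x) = op f (map_coef g x).
Proof.
have gD := @addm_linear _ _ _ g.
apply: op_commute => [|{}x|{}x|{}x]; first exact: map_coefD.
- exact: map_coef_der.
- exact: map_coef_shift.
- exact: map_coef_shift.
Qed.

Section Substitution.
Variables (V : lmodType {poly K}) (t1 t2 : form).

Let F (k : (nat * nat)%type) (v : V) := iter k.1 (op t1) (iter k.2 (op t2) v%:V).
Let FD k : addm (F k).
Proof.
by move=> u v; rewrite /F cstD !addm_iter //; exact: opD.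
Qed.

(* [x(λ,μ)] becomes [x(t1,t2)]. *)
Definition subst2 (x : vpoly (nat * nat)%type V) : vpoly (nat * nat)%type V :=
  msum F x.

Lemma subst2D : addm subst2.
Proof. exact: msumD. Qed.

Lemma subst2_cst v : subst2 v%:V = v%:V.
Proof. exact: (msumU FD). Qed.

Lemma op_iterC f g k (x : vpoly (nat * nat)%type V) :
  op g (iter k (op f) x) = iter k (op f) (op g x).
Proof.
elim: k => //= k <-.
symmetry; apply: op_commute => [|y|y|y]; first exact: opD.
all: by rewrite /lam /mu ?op_der ?op_shift.
Qed.

Lemma subst2_lam x : subst2 (lam x) = op t1 (subst2 x).
Proof.
move: x; apply: vpoly_ext => [||k v].
- exact: addm_comp subst2D (@vshiftD _ _ _ _).
- exact: addm_comp (@opD _ _) subst2D.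
- by rewrite /lam vshiftU /subst2 !msumU.
Qed.

Lemma subst2_mu x : subst2 (mu x) = op t2 (subst2 x).
Proof.
move: x; apply: vpoly_ext => [||k v].
- exact: addm_comp subst2D (@vshiftD _ _ _ _).
- exact: addm_comp (@opD _ _) subst2D.
(* The powers of [t1] are outermost in [F], so the new factor [t2] has to be moved across them. *)
- by rewrite /mu vshiftU /subst2 !msumU // /F op_iterC.
Qed.

Lemma subst2_der x : subst2 (der x) = op fder (subst2 x).
Proof.
rewrite op_fder; move: x; apply: (@lam_mu_ext _ _ _ (op t1) (op t2)) => [||x|x|x|x|v].
- exact: addm_comp subst2D (@derD _ _ _).
- exact: addm_comp (@derD _ _ _) subst2D.
- by rewrite /lam der_shift -/(lam _) subst2_lam.
- by rewrite subst2_lam op_der.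
- by rewrite /mu der_shift -/(mu _) subst2_mu.
- by rewrite subst2_mu op_der.
- by rewrite der_cst !subst2_cst der_cst.
Qed.

Lemma subst2_op f x : subst2 (op f x) = op (fsubst fder t1 t2 f) (subst2 x).
Proof. exact: (op_transport _ subst2D subst2_der subst2_lam subst2_mu). Qed.

Lemma subst2_subst f (w : vpoly nat V) :
  subst2 (subst (op f) w) = subst (op (fsubst fder t1 t2 f)) w.
Proof.
move: w; apply: (@lam1_ext _ _ _ (op (fsubst fder t1 t2 f))) => [||x|x|v].
- exact: addm_comp subst2D (substD (@opD _ _)).
- exact: (substD (@opD _ _)).
- by rewrite subst_lam1 ?subst2_op //; exact: opD.
- by rewrite subst_lam1 //; exact: opD.
- by rewrite !subst_cst ?subst2_cst //; exact: opD.
Qed.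

End Substitution.

(** The two hypotheses say that λ ↦ u1, μ ↦ u2 brings t1 back to λ and t2 back to μ. Since [subst2]
    fixes ∂ and constants, this substitution is a left inverse. *)
Lemma subst2_inj V (t1 t2 u1 u2 : form) :
  fsubst fder u1 u2 t1 = flam -> fsubst fder u1 u2 t2 = fmu ->
  injective (@subst2 V t1 t2).
Proof.
move=> t1K t2K; apply: (can_inj (g := subst2 u1 u2)).
apply: (@lam_mu_ext _ _ _ lam mu) => [||x|x|x|x|v] //.
- exact: addm_comp (@subst2D _ _ _) (@subst2D _ _ _).
- by rewrite subst2_lam subst2_op t1K op_flam.
- by rewrite subst2_mu subst2_op t2K op_fmu.
- by rewrite !subst2_cst.
Qed.

End Forms.

(** * Maps linear over the formal variables, and brackets of polynomials *)

Definition shift_morph (K : fieldType) (J : nmodType) (V W : lmodType {poly K})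
    (T : vpoly J V -> vpoly J W) : Prop :=
  addm T /\ forall m, {morph T : x / vshift m x}.

Definition shift_bimorph (K : fieldType) (J : nmodType) (U V W : lmodType {poly K})
    (f : vpoly J U -> vpoly J V -> vpoly J W) : Prop :=
  (forall y, shift_morph (f^~ y)) /\ (forall x, shift_morph (f x)).

Section ShiftMorphisms.
Variables (K : fieldType) (J : nmodType) (U V W : lmodType {poly K}).
Implicit Types (f g : vpoly J U -> vpoly J V -> vpoly J W).

(** Monomials can be pulled out of both arguments, so only constants remain to be compared.
    Identities between extended brackets are thus reduced to identities between the original
    ones. *)
Lemma shift_bimorph_ext f g : shift_bimorph f -> shift_bimorph g ->
  (forall u v, f (cst J u) (cst J v) = g (cst J u) (cst J v)) ->
  forall x y, f x y = g x y.
Proof.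
move=> [fl fr] [gl gr] fg x y; move: x.
apply: vpoly_ext => [||m u]; [exact: (fl y).1 | exact: (gl y).1|].
move: y; apply: vpoly_ext => [||n v]; [exact: (fr _).1 | exact: (gr _).1|].
rewrite -!vshift_cst.
rewrite (fl _).2 (fr _).2 [RHS](gl _).2.
by congr vshift; rewrite [RHS](gr _).2 fg.
Qed.

Lemma shift_bimorph_post (X : lmodType {poly K}) (T : vpoly J W -> vpoly J X) f :
  shift_morph T -> shift_bimorph f -> shift_bimorph (fun x y => T (f x y)).
Proof.
move=> [TD Tm] [fl fr]; split=> z; split=> [x y|m x].
- by rewrite /= (fl z).1 TD.
- by rewrite /= (fl z).2 Tm.
- by rewrite (fr z).1 TD.
- by rewrite (fr z).2 Tm.
Qed.

Lemma shift_bimorph_pre (U' V' : lmodType {poly K}) (S : vpoly J U' -> vpoly J U)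
    (T : vpoly J V' -> vpoly J V) f :
  shift_morph S -> shift_morph T -> shift_bimorph f ->
  shift_bimorph (fun x y => f (S x) (T y)).
Proof.
move=> [SD Sm] [TD Tm] [fl fr]; split=> z; split=> [x y|m x].
- by rewrite /= SD (fl _).1.
- by rewrite /= Sm (fl _).2.
- by rewrite TD (fr _).1.
- by rewrite Tm (fr _).2.
Qed.

Lemma shift_bimorphB f g : shift_bimorph f -> shift_bimorph g ->
  shift_bimorph (fun x y => f x y - g x y).
Proof.
move=> [fl fr] [gl gr]; split=> z; split=> [x y|m x].
- by rewrite /= (fl z).1 (gl z).1 opprD addrACA.
- by rewrite /= (fl z).2 (gl z).2 (addmB (@vshiftD _ _ _ m)).
- by rewrite (fr z).1 (gr z).1 opprD addrACA.
- by rewrite (fr z).2 (gr z).2 (addmB (@vshiftD _ _ _ m)).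
Qed.

End ShiftMorphisms.

Lemma shift_morph_id (K : fieldType) (J : nmodType) (V : lmodType {poly K}) :
  shift_morph (@id (vpoly J V)).
Proof. by []. Qed.

Lemma shift_morph_der (K : fieldType) (J : nmodType) (V : lmodType {poly K}) :
  shift_morph (@der K J V).
Proof. by split=> [|m x]; [exact: derD|exact: der_shift]. Qed.

Lemma shift_morph_op (K : fieldType) (V : lmodType {poly K}) f :
  shift_morph (@op K V f).
Proof. by split=> [|m x]; [exact: opD|exact: op_shift]. Qed.

Lemma shift_morph_map (K : fieldType) (J : nmodType) (V W : lmodType {poly K})
    (f : V -> W) : addm f -> shift_morph (@map_coef K J V W f).
Proof. by move=> fD; split=> [|m x]; [exact: map_coefD|exact: map_coef_shift]. Qed.

Section Ext.
Variables (K : fieldType) (U V W : lmodType {poly K}) (B : U -> V -> vpoly nat W).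
Hypothesis BD : biadditive B.
Local Notation N2 := (nat * nat)%type.

Section Generic.
Variables (J : nmodType) (theta : vpoly J W -> vpoly J W).
Hypothesis thetaD : addm theta.

Let Fr m u n v := vshift (m + n) (subst theta (B u v)).

Let FrD m u n : addm (Fr m u n).
Proof. exact: addm_comp (@vshiftD _ _ _ _) (addm_comp (substD thetaD) (BD.2 u)). Qed.

Let Fl y m u := msum (Fr m u) y.

Let FlD y m : addm (Fl y m).
Proof.
move=> u u'; rewrite /Fl /msum -big_split /=; apply: eq_bigr => n _.
by rewrite /Fr BD.1 (substD thetaD) vshiftD.
Qed.

Lemma ext2Dl y : addm (fun x => ext2 B theta x y).
Proof. exact: (msumD (FlD y)). Qed.

Lemma ext2Dr x : addm (ext2 B theta x).
Proof.
move=> y y'; rewrite /ext2 -big_split /=; apply: eq_bigr => m _.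
exact: (msumD (FrD m x@_m)).
Qed.

Lemma ext2U u m v n :
  ext2 B theta << u *g m >> << v *g n >> = vshift (m + n) (subst theta (B u v)).
Proof.
transitivity (Fl << v *g n >> m u); first exact: (msumU (FlD _)).
exact: (msumU (FrD _ _)).
Qed.

Lemma ext2_shiftl m x y : ext2 B theta (vshift m x) y = vshift m (ext2 B theta x y).
Proof.
move: x; apply: vpoly_ext => [||k u].
- exact: addm_comp (ext2Dl y) (@vshiftD _ _ _ _).
- exact: addm_comp (@vshiftD _ _ _ _) (ext2Dl y).
move: y; apply: vpoly_ext => [||n v].
- exact: ext2Dr.
- exact: addm_comp (@vshiftD _ _ _ _) (ext2Dr _).
- by rewrite vshiftU !ext2U vshiftA addrA.
Qed.

Lemma ext2_shiftr m x y : ext2 B theta x (vshift m y) = vshift m (ext2 B theta x y).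
Proof.
move: x; apply: vpoly_ext => [||k u].
- exact: ext2Dl.
- exact: addm_comp (@vshiftD _ _ _ _) (ext2Dl y).
move: y; apply: vpoly_ext => [||n v].
- exact: addm_comp (ext2Dr _) (@vshiftD _ _ _ _).
- exact: addm_comp (@vshiftD _ _ _ _) (ext2Dr _).
- by rewrite vshiftU !ext2U vshiftA addrCA.
Qed.

Lemma ext2_bimorph : shift_bimorph (ext2 B theta).
Proof.
by split=> z; split; [exact: ext2Dl|move=> m x; exact: ext2_shiftl|
                      exact: ext2Dr|move=> m x; exact: ext2_shiftr].
Qed.

Lemma ext2_cst u v : ext2 B theta (cst J u) (cst J v) = subst theta (B u v).
Proof. by rewrite ext2U addr0 vshift0. Qed.

(** The derivation conditions are written with [ext1] and all the others with [ext2]; this brings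
    them to one form. *)
Lemma ext1E u x : ext1 (B u) theta x = ext2 B theta (cst J u) x.
Proof.
transitivity (Fl x 0 u); last by rewrite [RHS](msumU (FlD x)).
by rewrite /Fl /msum /Fr; apply: eq_bigr => m _; rewrite add0r.
Qed.

End Generic.

Lemma ext2_biadd f : biadditive (ext2 B (op f)).
Proof. by split=> x; [apply: ext2Dl | apply: ext2Dr]; exact: opD. Qed.

Lemma ext2_op_bimorph f : shift_bimorph (ext2 B (op f)).
Proof. exact/ext2_bimorph/opD. Qed.

Lemma ext2_op_cst f u v : ext2 B (op f) u%:V v%:V = subst (op f) (B u v).
Proof. exact/ext2_cst/opD. Qed.

Hypothesis Bderl : forall u v, B ('X *: u) v = - lam1 (B u v).
Hypothesis Bderr : forall u v, B u ('X *: v) = (der \+ lam1) (B u v).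

(** Sesquilinearity with λ evaluated at f. Together with [ext2_derr] it says how ∂ is to be read
    when it leaves either argument of a bracket. *)
Lemma ext2_derl f x y :
  ext2 B (op f) (der x) y = op (- f) (ext2 B (op f) x y).
Proof.
move: x y; apply: shift_bimorph_ext => [||u v].
- apply: (shift_bimorph_pre (f := ext2 B (op f)) (@shift_morph_der _ _ _)
            (@shift_morph_id _ _ _)).
  exact: ext2_op_bimorph.
- exact: (shift_bimorph_post (shift_morph_op _ _) (ext2_op_bimorph _)).
- rewrite der_cst !ext2_op_cst.
  by rewrite Bderl (addmN (substD (@opD _ _ _))) subst_lam1 ?op_formN //; exact: opD.
Qed.

Lemma ext2_derr f x y :
  ext2 B (op f) x (der y) = op (fder + f) (ext2 B (op f) x y).
Proof.
move: x y; apply: shift_bimorph_ext => [||u v].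
- apply: (shift_bimorph_pre (f := ext2 B (op f)) (@shift_morph_id _ _ _)
            (@shift_morph_der _ _ _)).
  exact: ext2_op_bimorph.
- exact: (shift_bimorph_post (shift_morph_op _ _) (ext2_op_bimorph _)).
- rewrite der_cst !ext2_op_cst.
  rewrite Bderr /= (substD (@opD _ _ _)) subst_lam1; last exact: opD.
  by rewrite subst_der ?op_formD ?op_fder //; [exact: opD|move=> z; exact: op_der].
Qed.

Lemma ext2_opl f g x y :
  ext2 B (op f) (op g x) y = op (fsubst (- f) flam fmu g) (ext2 B (op f) x y).
Proof.
move: x; apply: op_transport => [|x|x|x]; first exact: (ext2_biadd f).1.
- exact: ext2_derl.
- by rewrite op_flam [LHS]ext2_shiftl //; exact: opD.
- by rewrite op_fmu [LHS]ext2_shiftl //; exact: opD.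
Qed.

Lemma ext2_opr f g x y :
  ext2 B (op f) x (op g y) = op (fsubst (fder + f) flam fmu g) (ext2 B (op f) x y).
Proof.
move: y; apply: op_transport => [|y|y|y]; first exact: (ext2_biadd f).2.
- exact: ext2_derr.
- by rewrite op_flam [LHS]ext2_shiftr //; exact: opD.
- by rewrite op_fmu [LHS]ext2_shiftr //; exact: opD.
Qed.

(* A ∂ occurring in [g] inside the bracket reads [∂ + f] outside of it, whence
   the side condition. *)
Lemma subst2_ext2r t1 t2 f g g' u (w : vpoly nat V) :
  let T := fsubst fder t1 t2 in
  T (fsubst (fder + f) flam fmu g) = fsubst (fder + T f) flam fmu g' ->
  subst2 t1 t2 (ext2 B (op f) u%:V (subst (op g) w))
  = ext2 B (op (T f)) u%:V (subst (op g') w).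
Proof.
move=> T gg'; have sD (M : lmodType {poly K}) h := substD (@opD K M h).
(* On the left the λ of [w] becomes [g], is then carried out of the bracket, then substituted; on
   the right it becomes [g'] and is carried out of the substituted bracket. The side condition
   equates the two results. *)
move: w; apply: (@lam1_ext _ _ _ (op (T (fsubst (fder + f) flam fmu g)))) => [||w|w|v].
- exact: addm_comp (@subst2D _ _ _ _) (addm_comp ((ext2_biadd f).2 _) (sD _ _)).
- exact: addm_comp ((ext2_biadd _).2 _) (sD _ _).
- by rewrite subst_lam1 ?ext2_opr ?subst2_op //; exact: opD.
- by rewrite subst_lam1 ?ext2_opr ?gg' //; exact: opD.
- by rewrite !subst_cst ?ext2_op_cst ?subst2_subst //; exact: opD.
Qed.

Lemma subst2_ext2l t1 t2 f g g' v (w : vpoly nat U) :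
  let T := fsubst fder t1 t2 in
  T (fsubst (- f) flam fmu g) = fsubst (- T f) flam fmu g' ->
  subst2 t1 t2 (ext2 B (op f) (subst (op g) w) v%:V)
  = ext2 B (op (T f)) (subst (op g') w) v%:V.
Proof.
move=> T gg'; have sD (M : lmodType {poly K}) h := substD (@opD K M h).
move: w; apply: (@lam1_ext _ _ _ (op (T (fsubst (- f) flam fmu g)))) => [||w|w|u].
- exact: addm_comp (@subst2D _ _ _ _) (addm_comp ((ext2_biadd f).1 _) (sD _ _)).
- exact: addm_comp ((ext2_biadd _).1 _) (sD _ _).
- by rewrite subst_lam1 ?ext2_opl ?subst2_op //; exact: opD.
- by rewrite subst_lam1 ?ext2_opl ?gg' //; exact: opD.
- by rewrite !subst_cst ?ext2_op_cst ?subst2_subst //; exact: opD.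
Qed.

End Ext.

(** * Opposite brackets *)

Section Opposite.
Variable K : fieldType.
Implicit Types (U V W : lmodType {poly K}).

(* [x(λ)] becomes [x(-∂-λ)]. *)
Definition flip V : vpoly nat V -> vpoly nat V := subst (\- (der \+ lam1)).

Lemma neg_der_lam1D V : addm (\- (der \+ @lam1 K V)).
Proof. by move=> x y; rewrite /= derD /lam1 vshiftD addrACA opprD. Qed.

Lemma flipD V : addm (@flip V).
Proof. exact: substD (@neg_der_lam1D V). Qed.

Lemma flip_lam1 V (x : vpoly nat V) : flip (lam1 x) = - (der (flip x) + lam1 (flip x)).
Proof. by rewrite /flip subst_lam1 //; exact: neg_der_lam1D. Qed.

Lemma flip_der V (x : vpoly nat V) : flip (der x) = der (flip x).
Proof.
rewrite /flip subst_der //; first exact: neg_der_lam1D.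
by move=> y /=; rewrite /lam1 -der_shift -derD -(addmN (@derD _ _ _)).
Qed.

(** -∂ - (-∂ - λ) = λ. *)
Lemma flipK V : involutive (@flip V).
Proof.
move=> x; rewrite -[RHS]subst_lam1_id.
apply: subst_comp => [|||y]; try exact: neg_der_lam1D; first exact: vshiftD.
rewrite -[LHS]/(flip (- (der y + lam1 y))) -[RHS]/(lam1 (flip y)).
rewrite (addmN (@flipD _)) flipD flip_lam1 flip_der.
by rewrite opprD opprK addrA addNr add0r.
Qed.

Lemma map_flip V W (g : {linear V -> W}) (x : vpoly nat V) :
  map_coef g (flip x) = flip (map_coef g x).
Proof.
have gD := @addm_linear _ _ _ g.
apply: map_subst => //; try exact: neg_der_lam1D.
move=> y /=; rewrite (addmN (map_coefD gD)) (map_coefD gD).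
by rewrite map_coef_der /lam1 map_coef_shift.
Qed.

Lemma subst_flip V f (x : vpoly nat V) :
  subst (op f) (flip x) = subst (op (- fder - f)) x.
Proof.
have oD := @opD K V; apply: subst_comp => // [|y]; first exact: neg_der_lam1D.
rewrite /= (addmN (substD (oD f))) (substD (oD f)) subst_lam1 // subst_der //.
  by rewrite -opprD op_formN op_formD op_fder.
by move=> z; exact: op_der.
Qed.

Lemma Klinear_add V W (f : V -> W) : Klinear f -> addm f.
Proof. by move=> fL x y; have := fL 1 x y; rewrite polyC1 !scale1r. Qed.

Lemma conformal_biadd U V W (B : U -> V -> vpoly nat W) :
  conformal_bilinear B -> biadditive B.
Proof. by case=> Bl Br _ _; split=> x; apply: Klinear_add. Qed.

Lemma KlinearP V W (f : V -> W) : addm f ->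
  (forall c x, f (c%:P *: x) = c%:P *: f x) -> Klinear f.
Proof. by move=> fD fZ c x y; rewrite fD fZ. Qed.

Lemma KlinearZ V W (f : V -> W) c x : Klinear f -> f (c%:P *: x) = c%:P *: f x.
Proof.
by move=> fL; have := fL c x 0; rewrite !addr0 (addm0 (Klinear_add fL)) addr0.
Qed.

Lemma scale_shift J V m p (x : vpoly J V) : p *: vshift m x = vshift m (p *: x).
Proof. by apply: map_coef_shift => u v; rewrite scalerDr. Qed.

Lemma flip_scale V p (x : vpoly nat V) : flip (p *: x) = p *: flip x.
Proof.
move: x; apply: (@lam1_ext _ _ _ (\- (der \+ lam1))) => [||x|x|v].
- by move=> x y; rewrite scalerDr flipD.
- by move=> x y; rewrite flipD scalerDr.
- by rewrite /lam1 scale_shift -/(lam1 _) flip_lam1.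
- rewrite /= flip_lam1 scalerN scalerDr /lam1 -scale_shift /der.
  by rewrite !scalerA mulrC.
- have -> : p *: cst nat v = cst nat (p *: v).
    by apply: map_coefU => u w; rewrite scalerDr.
  rewrite /flip !subst_cst; try exact: neg_der_lam1D.
  by symmetry; apply: map_coefU => u w; rewrite scalerDr.
Qed.

(** Since r(a) brackets with a on the right, it is the opposite bracket that makes r a map with a in
    the first argument, to be handled like l. *)
Definition opposite U V W (B : U -> V -> vpoly nat W) (v : V) (u : U) := flip (B u v).

(** Under λ ↦ -∂-λ the factors -λ and ∂+λ of the two sesquilinearity rules are exchanged, just as
    the arguments are. *)
Lemma opposite_bilinear U V W (B : U -> V -> vpoly nat W) :
  conformal_bilinear B -> conformal_bilinear (opposite B).
Proof.
move=> [Bl Br Bdl Bdr]; split=> u.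
- apply: KlinearP => [x y|c x]; rewrite /opposite.
    by rewrite (Klinear_add (Br u)) flipD.
  by rewrite KlinearZ // flip_scale.
- apply: KlinearP => [x y|c x]; rewrite /opposite.
    by rewrite (Klinear_add (Bl u)) flipD.
  by rewrite (KlinearZ _ _ (Bl u)) flip_scale.
- move=> v; rewrite /opposite Bdr /= flipD flip_der flip_lam1.
  by rewrite opprD addrA subrr add0r.
- move=> v; rewrite /opposite Bdl (addmN (@flipD _)) flip_lam1 opprK /=.
  by [].
Qed.

Section Operations.
Variables (U V W : lmodType {poly K}).

Lemma ext2_opposite (B : U -> V -> vpoly nat W) f x y : biadditive B ->
  ext2 (opposite B) (op f) x y = ext2 B (op (- fder - f)) y x.
Proof.
move=> BD; have oD : biadditive (opposite B).
  by split=> z u v; rewrite /opposite ?BD.1 ?BD.2 flipD.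
move: x y; apply: shift_bimorph_ext => [||u v].
- exact: ext2_op_bimorph.
- have [fl fr] := ext2_op_bimorph BD (- fder - f).
  by split=> z; [exact: fr|exact: fl].
- by rewrite (ext2_op_cst oD) (ext2_op_cst BD) subst_flip.
Qed.

Lemma map_ext2 (T : lmodType {poly K}) (g : {linear W -> T})
    (B : U -> V -> vpoly nat W) (C : U -> V -> vpoly nat T) f x y :
  biadditive B -> (forall u v, map_coef g (B u v) = C u v) ->
  map_coef g (ext2 B (op f) x y) = ext2 C (op f) x y.
Proof.
move=> BD BC; have gD := @addm_linear _ _ _ g; have mgD := map_coefD gD.
have CD : biadditive C.
  by split=> z u v; rewrite -!BC ?BD.1 ?BD.2 mgD.
move: x y; apply: shift_bimorph_ext => [||u v].
- exact: (shift_bimorph_post (shift_morph_map _ gD) (ext2_op_bimorph BD _)).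
- exact: ext2_op_bimorph.
- rewrite (ext2_op_cst CD) (ext2_op_cst BD).
  rewrite (@map_subst _ _ _ _ _ _ (op f)) ?BC //; try exact: opD.
  exact: map_coef_op.
Qed.

Lemma ext2_map (U' V' : lmodType {poly K}) (B : U -> V -> vpoly nat W)
    (g : {linear U' -> U}) (h : {linear V' -> V}) f x y : biadditive B ->
  ext2 (fun u v => B (g u) (h v)) (op f) x y
  = ext2 B (op f) (map_coef g x) (map_coef h y).
Proof.
move=> BD; have gD := @addm_linear _ _ _ g; have hD := @addm_linear _ _ _ h.
have CD : biadditive (fun u v => B (g u) (h v)).
  by split=> z u v; rewrite ?gD ?hD ?BD.1 ?BD.2.
move: x y; apply: shift_bimorph_ext => [||u v].
- exact: ext2_op_bimorph.
- apply: (shift_bimorph_pre (f := ext2 B (op f)) (shift_morph_map _ gD)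
            (shift_morph_map _ hD)).
  exact: ext2_op_bimorph.
- rewrite (map_coef_cst _ u gD) (map_coef_cst _ v hD).
  by rewrite (ext2_op_cst CD) (ext2_op_cst BD).
Qed.

Lemma ext2_subf (B C : U -> V -> vpoly nat W) f x y : biadditive B -> biadditive C ->
  ext2 (fun u v => B u v - C u v) (op f) x y = ext2 B (op f) x y - ext2 C (op f) x y.
Proof.
move=> BD CD; have SD : biadditive (fun u v => B u v - C u v).
  by split=> z u v; rewrite (BD.1, BD.2) (CD.1, CD.2) opprD addrACA.
move: x y; apply: shift_bimorph_ext => [||u v].
- exact: ext2_op_bimorph.
- exact: (shift_bimorphB (ext2_op_bimorph BD f) (ext2_op_bimorph CD f)).
- rewrite (ext2_op_cst SD) (ext2_op_cst BD) (ext2_op_cst CD).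
  exact: (addmB (substD (@opD _ _ _))).
Qed.

End Operations.
End Opposite.

(** * The Leibniz defect *)

(* [- x] is brought next to the leading [x] and cancelled, until nothing is left. *)
Ltac zmodule :=
  apply/eqP; rewrite -subr_eq0 !(opprD, opprK, oppr0, addr0, add0r) -?addrA; apply/eqP;
  repeat lazymatch goal with
  | |- - ?x + ?r = 0 => rewrite ?(addrCA _ x) 1?(addrC _ x) ?(addKr, addNr, addNKr)
  | |- ?x + ?r = 0 => rewrite ?(addrCA _ (- x)) 1?(addrC _ (- x)) ?(addKr, addNr, addNKr)
  end; try reflexivity.

(* Sealed, because a failing conversion between two unfolded [ext2] does not end. *)
HB.lock Definition bracket (K : fieldType) (U V W : lmodType {poly K})
    (B : U -> V -> vpoly nat W) (f : form) (x : vpoly (nat * nat)%type U)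
    (y : vpoly (nat * nat)%type V) : vpoly (nat * nat)%type W := ext2 B (op f) x y.

Lemma bracketE (K : fieldType) (U V W : lmodType {poly K})
    (B : U -> V -> vpoly nat W) f x y : bracket B f x y = ext2 B (op f) x y.
Proof. by rewrite unlock. Qed.

Lemma ext2_bracket (K : fieldType) (U V W : lmodType {poly K})
    (B : U -> V -> vpoly nat W) f : ext2 B (op f) = bracket B f.
Proof. by rewrite unlock. Qed.

Lemma bracket_biadd (K : fieldType) (U V W : lmodType {poly K})
    (B : U -> V -> vpoly nat W) f : biadditive B -> biadditive (bracket B f).
Proof. by move=> BD; rewrite -ext2_bracket; exact: ext2_biadd. Qed.

Section Defect.
Variables (K : fieldType) (E : lmodType {poly K}) (B : E -> E -> vpoly nat E).

Definition leibniz_defect (a b c : E) : vpoly (nat * nat)%type E :=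
  bracket B flam a%:V (bracket B fmu b%:V c%:V)
  - bracket B (flam + fmu) (bracket B flam a%:V b%:V) c%:V
  - bracket B fmu b%:V (bracket B flam a%:V c%:V).

Lemma leibniz_identityP :
  leibniz_identity B <-> forall a b c, leibniz_defect a b c = 0.
Proof.
have subP (A : zmodType) (x y z : A) : x = y + z <-> x - y - z = 0.
  split=> [->|/eqP]; first by rewrite addrAC addrK subrr.
  by rewrite subr_eq0 subr_eq addrC => /eqP.
by rewrite /leibniz_defect -!ext2_bracket !opE; split=> BL a b c; apply/subP; exact: BL.
Qed.

Hypothesis Bconf : conformal_bilinear B.
Let BD := conformal_biadd Bconf.

(* [f1], [f2], [f3] are the inner forms after the substitution, written in terms
   of the inner ∂. *)
Lemma subst2_defect t1 t2 t12 f1 f2 f3 a b c :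
  t1 + t2 = t12 ->
  t2 = fsubst (fder + t1) flam fmu f1 ->
  t1 = fsubst (- t12) flam fmu f2 ->
  t1 = fsubst (fder + t2) flam fmu f3 ->
  subst2 t1 t2 (leibniz_defect a b c) =
    bracket B t1 a%:V (bracket B f1 b%:V c%:V)
    - bracket B t12 (bracket B f2 a%:V b%:V) c%:V
    - bracket B t2 b%:V (bracket B f3 a%:V c%:V).
Proof.
move=> <- h1 h2 h3; have [_ _ Bl Br] := Bconf.
have fl : fsubst fder t1 t2 flam = t1 by exact: fcomb_lam.
have fm : fsubst fder t1 t2 fmu = t2 by exact: fcomb_mu.
have flm : fsubst fder t1 t2 (flam + fmu) = t1 + t2.
  by rewrite /fsubst fcombDl fcomb_lam fcomb_mu.
have cl d : fsubst d flam fmu flam = flam by exact: fcomb_lam.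
have cm d : fsubst d flam fmu fmu = fmu by exact: fcomb_mu.
have e1 := @subst2_ext2r _ _ _ _ _ BD Br t1 t2 flam fmu f1 a (B b c).
have e2 := @subst2_ext2l _ _ _ _ _ BD Bl t1 t2 (flam + fmu) flam f2 c (B a b).
have e3 := @subst2_ext2r _ _ _ _ _ BD Br t1 t2 fmu flam f3 b (B a c).
rewrite /= fl cm fm in e1; rewrite /= flm cl fl in e2; rewrite /= cl fl fm in e3.
rewrite -!ext2_bracket /leibniz_defect -!ext2_bracket !(ext2_op_cst BD).
rewrite -(e1 h1) -(e2 h2) -(e3 h3).
have subst2B := addmB (@subst2D K E t1 t2).
by rewrite 2!subst2B.
Qed.

Let addm_subf (A : zmodType) (f g : E -> A) :
  addm f -> addm g -> addm (fun x => f x - g x).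
Proof. by move=> fD gD x y; rewrite fD gD opprD addrACA. Qed.

Let X f y : addm (fun x => bracket B f x y) := (bracket_biadd f BD).1 y.
Let Y f x : addm (bracket B f x) := (bracket_biadd f BD).2 x.
Let c2D := @cstD K (nat * nat)%type E.

Lemma leibniz_defectD1 b c : addm (fun a => leibniz_defect a b c).
Proof.
rewrite /leibniz_defect; apply: addm_subf; first apply: addm_subf.
- exact: addm_comp (X _ _) c2D.
- exact: addm_comp (X (flam + fmu) c%:V) (addm_comp (X flam b%:V) c2D).
- exact: addm_comp (Y _ _) (addm_comp (X flam c%:V) c2D).
Qed.

Lemma leibniz_defectD2 a c : addm (fun b => leibniz_defect a b c).
Proof.
rewrite /leibniz_defect; apply: addm_subf; first apply: addm_subf.
- exact: addm_comp (Y _ _) (addm_comp (X fmu c%:V) c2D).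
- exact: addm_comp (X (flam + fmu) c%:V) (addm_comp (Y flam a%:V) c2D).
- exact: addm_comp (X _ _) c2D.
Qed.

Lemma leibniz_defectD3 a b : addm (leibniz_defect a b).
Proof.
rewrite /leibniz_defect; apply: addm_subf; first apply: addm_subf.
- exact: addm_comp (Y _ _) (addm_comp (Y fmu b%:V) c2D).
- exact: addm_comp (Y (flam + fmu) _) c2D.
- exact: addm_comp (Y _ _) (addm_comp (Y flam a%:V) c2D).
Qed.

End Defect.

(** * Images in E of the cocycle conditions *)

Section Transfer.
Variables (K : fieldType) (R H : leibniz_conformal K) (E : lmodType {poly K}).
Variable B : E -> E -> vpoly nat E.
Hypothesis Bconf : conformal_bilinear B.
Variables (i : {linear H -> E}) (s : {linear R -> E}).
Variables (l r : R -> H -> vpoly nat H) (chi : R -> R -> vpoly nat H).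
Hypotheses (lconf : conformal_bilinear l) (rconf : conformal_bilinear r).
Hypothesis chiconf : conformal_bilinear chi.
Hypothesis map_br : forall h k, map_coef i (br h k) = B (i h) (i k).
Hypothesis map_l : forall a h, map_coef i (l a h) = B (s a) (i h).
Hypothesis map_r : forall a h, map_coef i (r a h) = flip (B (i h) (s a)).
Hypothesis map_chi : forall a b,
  map_coef i (chi a b) = B (s a) (s b) - map_coef s (br a b).

Local Notation "[ x *_ f y ]" := (bracket B f x y)
  (at level 0, f at level 2, x at level 39, y at level 39, format "[ x  *_ f  y ]").
Local Notation mi := (map_coef i).
Local Notation ms := (map_coef s).

Let BD := conformal_biadd Bconf.
Let brD (L : leibniz_conformal K) : biadditive (@br K L) :=
  conformal_biadd (@br_bilinear K L).

Lemma map_bracket_br f x y : mi (bracket br f x y) = [mi x *_f mi y].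
Proof. by rewrite !bracketE (map_ext2 _ _ _ (brD H) map_br) (ext2_map _ _ _ _ _ BD). Qed.

Lemma map_bracket_l f x y : mi (bracket l f x y) = [ms x *_f mi y].
Proof.
rewrite !bracketE (map_ext2 _ _ _ (conformal_biadd lconf) map_l).
by rewrite (ext2_map _ _ _ _ _ BD).
Qed.

Lemma map_bracket_r f x y : mi (bracket r f x y) = [mi y *_(- fder - f) ms x].
Proof.
have oD : biadditive (opposite B) by exact/conformal_biadd/opposite_bilinear.
rewrite !bracketE (map_ext2 (C := fun a h => opposite B (s a) (i h)) _ _ _
           (conformal_biadd rconf) map_r).
by rewrite (ext2_map _ _ _ _ _ oD) (ext2_opposite _ _ _ BD).
Qed.

Lemma map_bracket_chi f x y :
  mi (bracket chi f x y) = [ms x *_f ms y] - ms (bracket br f x y).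
Proof.
have BsD : biadditive (fun a b => B (s a) (s b)).
  by split=> z u v; rewrite (addm_linear s) ?BD.1 ?BD.2.
have brsD : biadditive (fun a b => ms (br a b)).
  by split=> z u v; rewrite ?(brD R).1 ?(brD R).2 (map_coefD (@addm_linear _ _ _ s)).
rewrite !bracketE (map_ext2 _ _ _ (conformal_biadd chiconf) map_chi).
rewrite (ext2_subf _ _ _ BsD brsD).
rewrite (ext2_map _ _ _ _ _ BD).
by rewrite (map_ext2 (C := fun a b => ms (br a b)) _ _ _ (brD R) (fun _ _ => erefl)).
Qed.

Let iD : addm i := @addm_linear _ _ _ i.
Let sD : addm s := @addm_linear _ _ _ s.
Let miD : addm (@map_coef K (nat * nat)%type _ _ i) := map_coefD iD.
Let mi_cst h : mi h%:V = (i h)%:V := map_coef_cst _ h iD.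
Let ms_cst a : ms a%:V = (s a)%:V := map_coef_cst _ a sD.
Let bDl f y : addm (fun x => [x *_f y]) := (bracket_biadd f BD).1 y.
Let bDr f x : addm (bracket B f x) := (bracket_biadd f BD).2 x.
Let bBl f y x x' : [(x - x') *_f y] = [x *_f y] - [x' *_f y] := addmB (bDl f y) x x'.
Let bBr f y x x' : [y *_f (x - x')] = [y *_f x] - [y *_f x'] := addmB (bDr f y) x x'.

Local Notation D := (leibniz_defect B).

Let push :=
  (map_bracket_br, map_bracket_l, map_bracket_r, map_bracket_chi, mi_cst, ms_cst).


(** The term in l([a b]) cancels the part s([a b]) of χ(a,b). No substitution occurs, since a, b, h
    carry λ, μ, -∂-λ-μ in this order. *)
Lemma map_nab_ii a b h :
  mi (bracket l flam a%:V (bracket l fmu b%:V h%:V)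
      - bracket l fmu b%:V (bracket l flam a%:V h%:V)
      - bracket l (flam + fmu) (bracket br flam a%:V b%:V) h%:V
      - bracket br (flam + fmu) (bracket chi flam a%:V b%:V) h%:V)
  = D (s a) (s b) (i h).
Proof.
have Z (A : zmodType) (x y z w : A) : x - y - z - (w - z) = x - w - y by zmodule.
by rewrite 3!(addmB miD) !push bBl; exact: Z.
Qed.

Lemma map_CDerL a u v :
  mi (bracket l flam a%:V (bracket br fmu u%:V v%:V)
      - (bracket br fmu u%:V (bracket l flam a%:V v%:V)
         + bracket br (flam + fmu) (bracket l flam a%:V u%:V) v%:V))
  = D (s a) (i u) (i v).
Proof.
have Z (A : zmodType) (x y z : A) : x - (y + z) = x - z - y by zmodule.
by rewrite (addmB miD) miD !push; exact: Z.
Qed.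

(** In (iv) the map r(c) is taken at -∂-λ-μ, hence its opposite bracket at λ+μ, the outer form of
    the left-nested term of the defect. *)
Let flam_mu : - fder - (- (fder + flam + fmu)) = flam + fmu. Proof. by []. Qed.

(** In (iii) b carries μ and h carries -∂-λ-μ, while h stands before b in the triple: these two
    variables are exchanged. *)
Lemma map_nab_iii a b h :
  mi (bracket l flam a%:V (bracket r fmu b%:V h%:V)
      - bracket r fmu b%:V (bracket l flam a%:V h%:V)
      - bracket r (flam + fmu) (bracket br flam a%:V b%:V) h%:V
      - bracket br (- (fder + flam + fmu)) h%:V (bracket chi flam a%:V b%:V))
  = subst2 flam (- (fder + flam + fmu)) (D (s a) (i h) (s b)).
Proof.
have Z (A : zmodType) (x y z w : A) : x - y - z - (w - z) = x - y - w by zmodule.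
(* Inside the right argument of a bracket at λ, ∂ stands for ∂+λ; the inner form -∂-μ thus means
   -∂-λ-μ outside, which is the image of μ. *)
rewrite (subst2_defect (t12 := - fder - fmu) (f1 := - fder - fmu) (f2 := flam)
  (f3 := flam) Bconf) // 3!(addmB miD) !push bBr.
by rewrite (_ : - fder - (flam + fmu) = - (fder + flam + fmu)) //; exact: Z.
Qed.

(** Here u, v, a carry μ, -∂-λ-μ, λ: the substitution is a cyclic permutation of the three
    variables. *)
Lemma map_CDerR a u v :
  mi (bracket r flam a%:V (bracket br fmu u%:V v%:V)
      - (bracket br fmu u%:V (bracket r flam a%:V v%:V)
         - bracket br (- (fder + flam + fmu)) v%:V (bracket r flam a%:V u%:V)))
  = - subst2 fmu (- (fder + flam + fmu)) (D (i u) (i v) (s a)).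
Proof.
have Z (A : zmodType) (x y z : A) : x - (y - z) = - (y - x - z) by zmodule.
rewrite (subst2_defect (t12 := - fder - flam) (f1 := - fder - flam) (f2 := fmu)
  (f3 := - fder - flam) Bconf) // 2!(addmB miD) !push.
exact: Z.
Qed.

(** Two defects that differ by the exchange of their first two arguments, variables included, cancel
    in a sum except for the left-nested terms. This is the familiar fact that symmetrized brackets
    act as zero from the left in a Leibniz algebra. *)
Lemma map_nab_i1 a h1 h2 :
  mi (bracket br (flam + fmu) (bracket l flam a%:V h1%:V + bracket r flam a%:V h1%:V) h2%:V)
  = - (D (s a) (i h1) (i h2) + subst2 fmu flam (D (i h1) (s a) (i h2))).
Proof.
have Z (A : zmodType) (x y z w : A) : x + y = - (z - x - w + (w - y - z)) by zmodule.
(* In the left argument of a bracket at λ+μ, ∂ stands for -λ-μ, so the form -∂-λ coming from r(a)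
   there means μ. *)
rewrite (subst2_defect (t12 := flam + fmu) (f1 := flam) (f2 := - fder - flam)
  (f3 := fmu) Bconf) // map_bracket_br miD bDl !push.
exact: Z.
Qed.

(** The same cancellation for b and h, with a as third argument: the bracket of the symmetrized
    element with s(a) on its right is what r(a) expresses. *)
Lemma map_nab_i2 a b h :
  mi (bracket r flam a%:V (bracket r fmu b%:V h%:V + bracket l fmu b%:V h%:V))
  = - (subst2 fmu (- (fder + flam + fmu)) (D (s b) (i h) (s a))
       + subst2 (- (fder + flam + fmu)) fmu (D (i h) (s b) (s a))).
Proof.
have Z (A : zmodType) (x y z w : A) : x + y = - (z - y - w + (w - x - z)) by zmodule.
rewrite (subst2_defect (t12 := - fder - flam) (f1 := - fder - flam) (f2 := fmu)
  (f3 := - fder - flam) Bconf) //.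
rewrite (subst2_defect (t12 := - fder - flam) (f1 := - fder - flam) (f2 := - fder - fmu)
  (f3 := - fder - flam) Bconf) // map_bracket_r miD bDl !push.
exact: Z.
Qed.

(** Each of the three terms in which χ meets a bracket of R leaves an iterated bracket of R under s;
    together they form the Leibniz defect of R, which its own identity kills. *)
Lemma map_nab_iv a b c :
  mi (bracket chi flam a%:V (bracket br fmu b%:V c%:V)
      - bracket chi fmu b%:V (bracket br flam a%:V c%:V)
      - bracket chi (flam + fmu) (bracket br flam a%:V b%:V) c%:V
      + bracket l flam a%:V (bracket chi fmu b%:V c%:V)
      - bracket l fmu b%:V (bracket chi flam a%:V c%:V)
      - bracket r (- (fder + flam + fmu)) c%:V (bracket chi flam a%:V b%:V))
  = D (s a) (s b) (s c) - ms (leibniz_defect br a b c).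
Proof.
have Z (A : zmodType) (x1 x2 x3 y1 y2 y3 z1 z2 z3 : A) :
    (x1 - y1) - (x2 - y2) - (x3 - y3) + (z1 - x1) - (z2 - x2) - (z3 - x3)
    = z1 - z3 - z2 - (y1 - y3 - y2) by zmodule.
have msB := addmB (map_coefD sD).
rewrite 2!(addmB miD) miD 2!(addmB miD) !push flam_mu bBl 2!bBr /leibniz_defect 2!msB.
exact: Z.
Qed.

Lemma map_defect u v w : mi (leibniz_defect br u v w) = D (i u) (i v) (i w).
Proof. by rewrite /leibniz_defect 2!(addmB miD) !push. Qed.

End Transfer.

(** * Cocycles and Leibniz identities *)

Lemma sub_eq0P (A : zmodType) (x y : A) : x = y <-> x - y = 0.
Proof. by split=> [->|/eqP]; [rewrite subrr|rewrite subr_eq0 => /eqP]. Qed.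

Section ConformalBilinear.
Variable K : fieldType.
Implicit Types U V W : lmodType {poly K}.

Lemma map_coefZ V W (g : {linear V -> W}) p (x : vpoly nat V) :
  map_coef g (p *: x) = p *: map_coef g x.
Proof.
have gD := @addm_linear _ _ _ g.
move: x; apply: vpoly_ext => [x y|x y|k v].
- by rewrite scalerDr (map_coefD gD).
- by rewrite (map_coefD gD) scalerDr.
have pD (M : lmodType {poly K}) : addm (fun m : M => p *: m).
  by move=> x y; rewrite scalerDr.
have pU (M : lmodType {poly K}) (m : M) :
    p *: (<< m *g k >> : vpoly nat M) = << p *: m *g k >>.
  exact: (map_coefU k m (pD M)).
by rewrite (map_coefU _ _ gD) !pU (map_coefU _ _ gD) linearZ.
Qed.

Lemma conformal_bilinear_map U V W W' (g : {linear W -> W'}) (B : U -> V -> vpoly nat W) :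
  conformal_bilinear B -> conformal_bilinear (fun u v => map_coef g (B u v)).
Proof.
have gD := map_coefD (@addm_linear _ _ _ g); have gN := addmN (gD nat).
move=> [Bl Br Bdl Bdr]; split.
- by move=> v c x y; rewrite Bl gD map_coefZ.
- by move=> u c x y; rewrite Br gD map_coefZ.
- by move=> u v; rewrite Bdl gN /lam1 map_coef_shift //; exact: addm_linear.
- move=> u v; rewrite Bdr /= gD map_coef_der /lam1 map_coef_shift //.
  exact: addm_linear.
Qed.

Lemma conformal_bilinear_pre U U' V V' W (f : {linear U' -> U}) (g : {linear V' -> V})
    (B : U -> V -> vpoly nat W) :
  conformal_bilinear B -> conformal_bilinear (fun u v => B (f u) (g v)).
Proof.
move=> [Bl Br Bdl Bdr]; split.
- by move=> v c x y; rewrite linearP Bl.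
- by move=> u c x y; rewrite linearP Br.
- by move=> u v; rewrite linearZ Bdl.
- by move=> u v; rewrite linearZ Bdr.
Qed.

Lemma conformal_bilinearD U V W (B C : U -> V -> vpoly nat W) :
  conformal_bilinear B -> conformal_bilinear C ->
  conformal_bilinear (fun u v => B u v + C u v).
Proof.
move=> [Bl Br Bdl Bdr] [Cl Cr Cdl Cdr]; split.
- by move=> v c x y; rewrite Bl Cl scalerDr addrACA.
- by move=> u c x y; rewrite Br Cr scalerDr addrACA.
- by move=> u v; rewrite Bdl Cdl -opprD /lam1 vshiftD.
- by move=> u v; rewrite Bdr Cdr /= derD /lam1 vshiftD addrACA.
Qed.

Lemma ext1_lam U V W (B : U -> V -> vpoly nat W) u (x : vpoly (nat * nat)%type V) :
  conformal_bilinear B -> ext1 (B u) lam x = ext2 B lam u%:V x.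
Proof. by move=> /conformal_biadd BD; apply: ext1E => //; exact: vshiftD. Qed.

End ConformalBilinear.

Section CocycleOfLeibniz.
Variables (K : fieldType) (R H : leibniz_conformal K) (E : lmodType {poly K}).
Variable B : E -> E -> vpoly nat E.
Hypothesis Bconf : conformal_bilinear B.
Variables (i : {linear H -> E}) (s : {linear R -> E}).
Hypothesis i_inj : injective i.
Variables (l r : R -> H -> vpoly nat H) (chi : R -> R -> vpoly nat H).
Hypotheses (lconf : conformal_bilinear l) (rconf : conformal_bilinear r).
Hypothesis chiconf : conformal_bilinear chi.
Hypothesis map_br : forall h k, map_coef i (br h k) = B (i h) (i k).
Hypothesis map_l : forall a h, map_coef i (l a h) = B (s a) (i h).
Hypothesis map_r : forall a h, map_coef i (r a h) = flip (B (i h) (s a)).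
Hypothesis map_chi : forall a b,
  map_coef i (chi a b) = B (s a) (s b) - map_coef s (br a b).

Local Notation mi := (map_coef i : vpoly (nat * nat)%type H -> vpoly (nat * nat)%type E).
Local Notation D := (leibniz_defect B).

Let miD : addm mi := map_coefD (@addm_linear _ _ _ i).

Lemma cocycle_of_leibniz : leibniz_identity B ->
  exists z : nab_cocycle R H, [/\ cl z = l, cr z = r & cchi z = chi].
Proof.
move=> /leibniz_identityP BL.
have mi0 x : mi x = 0 -> x = 0.
  move=> x0; apply: (map_coef_inj (@addm_linear _ _ _ i) i_inj).
  by rewrite x0 (addm0 miD).
have s0 t1 t2 a b c : subst2 t1 t2 (D a b c) = 0 by rewrite BL (addm0 (@subst2D _ _ _ _)).
have DL a : CDerL (l a).
  have [Ll Lr Ldl Ldr] := lconf; split; first by split; [exact: Lr | exact: Ldr].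
  move=> u v; rewrite !(ext1_lam _ _ lconf); apply/sub_eq0P/mi0.
  have := map_CDerL Bconf lconf map_br map_l a u v.
  by rewrite BL -!ext2_bracket !opE.
have DR a : CDerR (r a).
  have [Ll Lr Ldl Ldr] := rconf; split; first by split; [exact: Lr | exact: Ldr].
  move=> u v; rewrite !(ext1_lam _ _ rconf); apply/sub_eq0P/mi0.
  have := map_CDerR Bconf rconf map_br map_r a u v.
  by rewrite s0 oppr0 -!ext2_bracket !opE.
have homl : conformal_hom l by have [? _ ? _] := lconf.
have homr : conformal_hom r by have [? _ ? _] := rconf.
unshelve eexists (@NabCocycle _ _ _ l r chi chiconf DL homl DR homr _ _ _ _ _) => //.
- move=> a h1 h2; apply: mi0.
  have := map_nab_i1 Bconf lconf rconf map_br map_l map_r a h1 h2.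
  by rewrite BL s0 addr0 oppr0 -!ext2_bracket !opE.
- move=> a b h; apply: mi0.
  have := map_nab_i2 Bconf lconf rconf map_l map_r a b h.
  by rewrite !s0 addr0 oppr0 -!ext2_bracket !opE.
- move=> a b h; apply/sub_eq0P/mi0.
  have := map_nab_ii Bconf lconf chiconf map_br map_l map_chi a b h.
  by rewrite BL -!ext2_bracket !opE.
- move=> a b h; apply/sub_eq0P/mi0.
  have := map_nab_iii Bconf lconf rconf chiconf map_br map_l map_r map_chi a b h.
  by rewrite s0 -!ext2_bracket !opE.
- move=> a b c; apply: mi0.
  have := map_nab_iv Bconf lconf rconf chiconf map_l map_r map_chi a b c.
  have /leibniz_identityP -> := @br_leibniz K R.
  by rewrite BL (addm0 (map_coefD (@addm_linear _ _ _ s))) subr0 -!ext2_bracket !opE.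
Qed.

End CocycleOfLeibniz.

Lemma cl_bilinear (K : fieldType) (R H : leibniz_conformal K) (z : nab_cocycle R H) :
  conformal_bilinear (cl z).
Proof.
by have [? ?] := cl_hom z; split=> // a; have [[] ] := cl_CDerL z a.
Qed.

Lemma cr_bilinear (K : fieldType) (R H : leibniz_conformal K) (z : nab_cocycle R H) :
  conformal_bilinear (cr z).
Proof.
by have [? ?] := cr_hom z; split=> // a; have [[] ] := cr_CDerR z a.
Qed.

Section LeibnizOfCocycle.
Variables (K : fieldType) (R H : leibniz_conformal K) (E : lmodType {poly K}).
Variable B : E -> E -> vpoly nat E.
Hypothesis Bconf : conformal_bilinear B.
Variables (i : {linear H -> E}) (s : {linear R -> E}).
Hypothesis is_span : forall x, exists a h, x = s a + i h.
Variable z : nab_cocycle R H.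
Hypothesis map_br : forall h k, map_coef i (br h k) = B (i h) (i k).
Hypothesis map_l : forall a h, map_coef i (cl z a h) = B (s a) (i h).
Hypothesis map_r : forall a h, map_coef i (cr z a h) = flip (B (i h) (s a)).
Hypothesis map_chi : forall a b,
  map_coef i (cchi z a b) = B (s a) (s b) - map_coef s (br a b).

Local Notation mi := (map_coef i : vpoly (nat * nat)%type H -> vpoly (nat * nat)%type E).
Local Notation D := (leibniz_defect B).

Let lconf := cl_bilinear z.
Let rconf := cr_bilinear z.
Let chiconf := cchi_bilinear z.
Let miD : addm mi := map_coefD (@addm_linear _ _ _ i).

Let mi0 x : x = 0 -> mi x = 0.
Proof. by move=> ->; exact: addm0 miD. Qed.

Let subst2_0 t1 t2 u1 u2 (x : vpoly (nat * nat)%type E) :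
  fsubst fder u1 u2 t1 = flam -> fsubst fder u1 u2 t2 = fmu ->
  subst2 t1 t2 x = 0 -> x = 0.
Proof.
move=> h1 h2 x0; apply: (subst2_inj h1 h2).
by rewrite x0 (addm0 (@subst2D _ _ _ _)).
Qed.

Let defect_RRR a b c : D (s a) (s b) (s c) = 0.
Proof.
have := map_nab_iv Bconf lconf rconf chiconf map_l map_r map_chi a b c.
have /leibniz_identityP -> := @br_leibniz K R.
rewrite (addm0 (map_coefD (@addm_linear _ _ _ s))) subr0 => <-.
by rewrite -!ext2_bracket !opE; apply: mi0; exact: nab_iv.
Qed.

Let defect_RRH a b h : D (s a) (s b) (i h) = 0.
Proof.
rewrite -(map_nab_ii Bconf lconf chiconf map_br map_l map_chi) -!ext2_bracket !opE.
apply: mi0; apply: (sub_eq0P _ _).1; exact: nab_ii.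
Qed.

Let defect_RHR a h b : D (s a) (i h) (s b) = 0.
Proof.
apply: (@subst2_0 flam (- (fder + flam + fmu)) flam (- (fder + flam + fmu))) => //.
rewrite -(map_nab_iii Bconf lconf rconf chiconf map_br map_l map_r map_chi).
rewrite -!ext2_bracket !opE; apply: mi0; apply: (sub_eq0P _ _).1; exact: nab_iii.
Qed.

Let defect_RHH a u v : D (s a) (i u) (i v) = 0.
Proof.
rewrite -(map_CDerL Bconf lconf map_br map_l) -!ext2_bracket !opE.
apply: mi0; apply: (sub_eq0P _ _).1; rewrite -!(ext1_lam _ _ lconf).
exact: (cl_CDerL z a).2.
Qed.

Let defect_HHR u v a : D (i u) (i v) (s a) = 0.
Proof.
(* The only one of the four substitutions inverted in this section that is not an involution: the
   inverse of the 3-cycle is the other 3-cycle. *)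
apply: (@subst2_0 fmu (- (fder + flam + fmu)) (- (fder + flam + fmu)) flam) => //.
apply: oppr_inj; rewrite oppr0 -(map_CDerR Bconf rconf map_br map_r) -!ext2_bracket !opE.
apply: mi0; apply: (sub_eq0P _ _).1; rewrite -!(ext1_lam _ _ rconf).
exact: (cr_CDerR z a).2.
Qed.

Let defect_HRH h a k : D (i h) (s a) (i k) = 0.
Proof.
apply: (@subst2_0 fmu flam fmu flam) => //.
have := map_nab_i1 Bconf lconf rconf map_br map_l map_r a h k.
rewrite defect_RHH add0r -!ext2_bracket !opE nab_i1 (addm0 miD).
by move/esym/(canRL opprK); rewrite oppr0.
Qed.

Let defect_HRR h b a : D (i h) (s b) (s a) = 0.
Proof.
apply: (@subst2_0 (- (fder + flam + fmu)) fmu (- (fder + flam + fmu)) fmu) => //.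
have := map_nab_i2 Bconf lconf rconf map_l map_r a b h.
rewrite defect_RHR (addm0 (@subst2D _ _ _ _)) add0r -!ext2_bracket !opE nab_i2 (addm0 miD).
by move/esym/(canRL opprK); rewrite oppr0.
Qed.

Let defect_HHH u v w : D (i u) (i v) (i w) = 0.
Proof.
rewrite -(map_defect Bconf map_br); apply: mi0.
by have /leibniz_identityP -> := @br_leibniz K H.
Qed.

Lemma leibniz_of_cocycle : leibniz_identity B.
Proof.
apply/leibniz_identityP => x y t.
have [a [h ->]] := is_span x; have [b [k ->]] := is_span y.
have [c [w ->]] := is_span t.
rewrite (leibniz_defectD1 Bconf) !(leibniz_defectD2 Bconf) !(leibniz_defectD3 Bconf).
rewrite defect_RRR defect_RRH defect_RHR defect_RHH.
by rewrite defect_HRR defect_HRH defect_HHR defect_HHH !addr0.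
Qed.

End LeibnizOfCocycle.

(** * The extension of a cocycle *)

Section ProductExtension.
Variables (K : fieldType) (R H : leibniz_conformal K) (z : nab_cocycle R H).

Local Notation E := (lc_sort R * lc_sort H)%type.

Definition prod_inj (h : H) : E := (0, h).
Definition prod_sec (a : R) : E := (a, 0).

Fact prod_inj_linear : linear prod_inj.
Proof. by move=> p h k; rewrite /prod_inj -[RHS]/(p *: 0 + 0, p *: h + k) scaler0 addr0. Qed.
Fact prod_sec_linear : linear prod_sec.
Proof. by move=> p h k; rewrite /prod_sec -[RHS]/(p *: h + k, p *: 0 + 0) scaler0 addr0. Qed.

HB.instance Definition _ := GRing.isLinear.Build {poly K} H E _ prod_inj prod_inj_linear.
HB.instance Definition _ := GRing.isLinear.Build {poly K} R E _ prod_sec prod_sec_linear.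

(** Forced by expanding [(s a + h)_λ (s b + k)]: [s a, s b] is s([a b]) + χ(a,b), [s a, k] is l(a)
    k, and [h, s b] is r(b) h at -∂-λ, whence [opposite]. *)
Definition prod_br (x y : E) : vpoly nat E :=
  map_coef prod_sec (br x.1 y.1)
  + map_coef prod_inj (cchi z x.1 y.1 + cl z x.1 y.2 + opposite (cr z) x.2 y.1 + br x.2 y.2).

Lemma prod_br_bilinear : conformal_bilinear prod_br.
Proof.
have pre (M N P : lmodType {poly K}) (f : {linear E -> M}) (g : {linear E -> N})
    (B : M -> N -> vpoly nat P) (cB : conformal_bilinear B) := conformal_bilinear_pre f g cB.
apply: conformal_bilinearD.
  exact: (conformal_bilinear_map prod_sec (pre _ _ _ fst fst _ (@br_bilinear K R))).
apply: (conformal_bilinear_map prod_inj).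
apply: conformal_bilinearD; last exact: (pre _ _ _ snd snd _ (@br_bilinear K H)).
apply: conformal_bilinearD.
  apply: conformal_bilinearD; first exact: (pre _ _ _ fst fst _ (cchi_bilinear z)).
  exact: (pre _ _ _ fst snd _ (cl_bilinear z)).
exact: (pre _ _ _ snd fst _ (opposite_bilinear (cr_bilinear z))).
Qed.

Let chiD := conformal_biadd (cchi_bilinear z).
Let lD := conformal_biadd (cl_bilinear z).
Let rD := conformal_biadd (opposite_bilinear (cr_bilinear z)).
Let brRD := conformal_biadd (@br_bilinear K R).
Let brHD := conformal_biadd (@br_bilinear K H).
Let secD := map_coefD (@addm_linear _ _ _ prod_sec) (J := nat).

Lemma prod_br_inj h k : map_coef prod_inj (br h k) = prod_br (prod_inj h) (prod_inj k).
Proof.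
rewrite /prod_br /= (addm0 (brRD.2 0)) (addm0 secD) add0r.
by rewrite (addm0 (chiD.2 0)) (addm0 (lD.1 k)) (addm0 (rD.2 h)) !add0r.
Qed.

Lemma prod_br_l a h : map_coef prod_inj (cl z a h) = prod_br (prod_sec a) (prod_inj h).
Proof.
rewrite /prod_br /= (addm0 (brRD.2 a)) (addm0 secD) add0r.
by rewrite (addm0 (chiD.2 a)) (addm0 (rD.2 0)) (addm0 (brHD.1 h)) !addr0 add0r.
Qed.

Lemma prod_br_r a h :
  map_coef prod_inj (cr z a h) = flip (prod_br (prod_inj h) (prod_sec a)).
Proof.
rewrite /prod_br /= (addm0 (brRD.1 a)) (addm0 secD) add0r.
rewrite (addm0 (chiD.1 a)) (addm0 (lD.2 0)) (addm0 (brHD.2 h)) addr0 !add0r.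
by rewrite -map_flip /opposite flipK.
Qed.

Lemma prod_br_chi a b : map_coef prod_inj (cchi z a b)
  = prod_br (prod_sec a) (prod_sec b) - map_coef prod_sec (br a b).
Proof.
rewrite /prod_br /= (addm0 (lD.2 a)) (addm0 (rD.1 b)) (addm0 (brHD.2 0)) !addr0.
by rewrite addrC addKr.
Qed.

Lemma prod_decomp (x : E) : x = prod_sec x.1 + prod_inj x.2.
Proof.
by case: x => a h; rewrite /prod_sec /prod_inj /= -[RHS]/(a + 0, 0 + h) addr0 add0r.
Qed.

Lemma prod_leibniz : leibniz_identity prod_br.
Proof.
apply: (leibniz_of_cocycle prod_br_bilinear _ prod_br_inj prod_br_l prod_br_r prod_br_chi).
by move=> x; exists x.1, x.2; exact: prod_decomp.
Qed.

Lemma prod_fg : finitely_generated E.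
Proof.
have [m [g gP]] := lc_fg R; have [n [k kP]] := lc_fg H.
exists (m + n)%N.
exists (fun j => match split j with inl a => prod_sec (g a) | inr b => prod_inj (k b) end).
move=> x; have [c cP] := gP x.1; have [d dP] := kP x.2.
exists (fun j => match split j with inl a => c a | inr b => d b end).
rewrite big_split_ord /= [LHS]prod_decomp; congr (_ + _).
- rewrite {1}cP linear_sum; apply: eq_bigr => j _.
  by rewrite linearZ /= -[lshift n j]/(unsplit (inl j)) unsplitK.
- rewrite {1}dP linear_sum; apply: eq_bigr => j _.
  by rewrite linearZ /= -[rshift m j]/(unsplit (inr j)) unsplitK.
Qed.

Definition prod_algebra : leibniz_conformal K :=
  LeibnizConformal prod_fg prod_br_bilinear prod_leibniz.

Lemma prod_fst_hom : preserves_bracket (fst : {linear prod_algebra -> R}).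
Proof.
move=> x y; rewrite /= /prod_br.
have fD := @addm_linear _ _ _ (fst : {linear E -> R}).
have sD := @addm_linear _ _ _ prod_sec; have iD := @addm_linear _ _ _ prod_inj.
rewrite (map_coefD fD) (map_coef_comp _ fD sD) (map_coef_comp _ fD iD).
rewrite [X in X + _](_ : _ = br x.1 y.1); last exact: map_coef_id.
rewrite [X in _ + X](_ : _ = 0) ?addr0 //.
by apply/malgP => k; rewrite mcoeff_map_coef // mcoeff0.
Qed.

(** Kept transparent: [prod_cocycle] and [prod_sec_section] need its inclusion and projection to
    reduce to [prod_inj] and [fst]. *)
Definition prod_extension : extension R H.
Proof.
apply: (@Extension K R H prod_algebra prod_inj fst prod_br_inj prod_fst_hom).
- by move=> h k [].
- by move=> a; exists (a, 0).
- move=> [a h]; split=> /= [->|[k [-> _]]] //.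
  by exists h.
Defined.

Definition prod_split_extension : split_extension R H.
Proof. by exists prod_extension; exists (prod_sec : {linear R -> E}). Defined.

Lemma prod_cocycle :
  @cocycle_of_section K R H prod_split_extension (prod_sec : {linear R -> E}) z.
Proof. by split; [exact: prod_br_l | exact: prod_br_r | exact: prod_br_chi]. Qed.

End ProductExtension.

(** * Sections and equivalences *)

Section Sections.
Variables (K : fieldType) (R H : leibniz_conformal K) (E : extension R H).
Variable s : {linear R -> E}.
Hypothesis sP : is_section s.

Local Notation i := (ext_inj E).
Local Notation p := (ext_proj E).

Lemma proj_inj h : p (i h) = 0.
Proof. by apply/ext_exact; exists h. Qed.

(** A section splits E as R + H over the polynomial ring, and [q] is the projection to H: x - s(p x)
    lies in the kernel of p, and injectivity of the inclusion makes its preimage linear in x. *)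
Lemma section_retraction :
  exists q : {linear E -> H}, forall x, i (q x) = x - s (p x).
Proof.
have ex x : exists h, i h == x - s (p x).
  have [h hP] : exists h, x - s (p x) = i h.
    by apply/ext_exact; rewrite linearB /= sP subrr.
  by exists h; rewrite hP.
pose q x := xchoose (ex x).
have qP x : i (q x) = x - s (p x) by exact/eqP/(xchooseP (ex x)).
have q_lin : linear q.
  move=> a x y; apply: (@ext_inj_inj _ _ _ E).
  by rewrite linearP !qP !linearP /= scalerDr addrACA.
pose qL := GRing.isLinear.Build _ _ _ _ q q_lin.
by exists (HB.pack_for {linear E -> H} q qL) => x; exact: qP.
Qed.

Lemma map_retraction (q : {linear E -> H}) (x : vpoly nat E) :
  (forall x, i (q x) = x - s (p x)) ->
  map_coef i (map_coef q x) = x - map_coef s (map_coef p x).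
Proof.
move=> qP; have iD := @addm_linear _ _ _ i; have qD := @addm_linear _ _ _ q.
have sD := @addm_linear _ _ _ s; have pD := @addm_linear _ _ _ p.
rewrite (map_coef_comp _ iD qD) (map_coef_comp _ sD pD).
rewrite (_ : i \o q = fun x => id x - (s \o p) x); last exact/funext.
rewrite (@map_coef_subf _ _ _ _ id (s \o p)) ?map_coef_id //.
exact: addm_comp.
Qed.

Let brD (L : leibniz_conformal K) : biadditive (@br K L) :=
  conformal_biadd (@br_bilinear K L).

Lemma section_cocycle : exists z : nab_cocycle R H, cocycle_of_section s z.
Proof.
have [q qP] := section_retraction.
(* Brackets with one argument in H already lie in H, where [q] changes nothing. For χ, [q] removes
   exactly s([a b]), as p maps [s a, s b] to [a b]. Conformal bilinearity is then inherited from the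
   bracket of E. *)
pose l a h := map_coef q (br (s a) (i h)).
pose r a h := map_coef q (opposite br (s a) (i h)).
pose chi a b := map_coef q (br (s a) (s b)).
have br0 x y : p x = 0 \/ p y = 0 -> map_coef p (br x y) = 0.
  rewrite ext_proj_hom => -[]->; [exact: addm0 ((brD R).1 _)|exact: addm0 ((brD R).2 _)].
have s0 : map_coef s (0 : vpoly nat R) = 0 := addm0 (map_coefD (@addm_linear _ _ _ s)).
have map_l a h : map_coef i (l a h) = br (s a) (i h).
  by rewrite /l (map_retraction _ qP) br0 ?s0 ?subr0 // proj_inj; right.
have map_r a h : map_coef i (r a h) = flip (br (i h) (s a)).
  rewrite /r (map_retraction _ qP) /opposite map_flip br0 ?proj_inj; last by left.
  by rewrite (addm0 (@flipD _ _)) s0 subr0.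
have map_chi a b : map_coef i (chi a b) = br (s a) (s b) - map_coef s (br a b).
  by rewrite /chi (map_retraction _ qP) ext_proj_hom !sP.
have lconf : conformal_bilinear l.
  exact: (conformal_bilinear_map q (conformal_bilinear_pre s i (@br_bilinear K E))).
have rconf : conformal_bilinear r.
  exact: (conformal_bilinear_map q
    (conformal_bilinear_pre s i (opposite_bilinear (@br_bilinear K E)))).
have chiconf : conformal_bilinear chi.
  exact: (conformal_bilinear_map q (conformal_bilinear_pre s s (@br_bilinear K E))).
have [z [zl zr zchi]] := cocycle_of_leibniz (@br_bilinear K E) (@ext_inj_inj _ _ _ E)
  lconf rconf chiconf (@ext_inj_hom _ _ _ E) map_l map_r map_chi (@br_leibniz K E).
by exists z; split=> *; rewrite ?zl ?zr ?zchi ?map_l ?map_r ?map_chi.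
Qed.

End Sections.

Section Equivalence.
Variables (K : fieldType) (R H : leibniz_conformal K) (E E' : split_extension R H).
Variables (s : {linear R -> E}) (s' : {linear R -> E'}) (z z' : nab_cocycle R H).
Hypotheses (sP : is_section s) (sP' : is_section s').
Hypotheses (zP : cocycle_of_section s z) (zP' : cocycle_of_section s' z').

Local Notation i := (ext_inj E).
Local Notation i' := (ext_inj E').
Local Notation p := (ext_proj E).
Local Notation p' := (ext_proj E').

Let brD (L : leibniz_conformal K) : biadditive (@br K L) :=
  conformal_biadd (@br_bilinear K L).
Let brBl (L : leibniz_conformal K) (x y t : L) : br (x - y) t = br x t - br y t :=
  addmB ((brD L).1 t) x y.
Let brBr (L : leibniz_conformal K) (x y t : L) : br t (x - y) = br t x - br t y :=
  addmB ((brD L).2 t) x y.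
Let brDD (L : leibniz_conformal K) (x y t u : L) :
  br (x + y) (t + u) = br x t + br x u + (br y t + br y u).
Proof. by rewrite (brD L).1 !(brD L).2. Qed.
Let linD (V W : lmodType {poly K}) (f : {linear V -> W}) : addm f := @addm_linear _ _ _ f.
Let mapD (V W : lmodType {poly K}) (f : {linear V -> W}) : addm (@map_coef K nat _ _ f) :=
  map_coefD (linD f).
Let mapB (V W : lmodType {poly K}) (f : {linear V -> W}) := addmB (mapD f).

(** The map φ∘s is a second section of E', and its cocycle is again z because φ preserves brackets
    and fixes H. What remains is a change of section inside E'. *)
Lemma equiv_cocycle_of_extension : equiv_extension E E' -> equiv_cocycle z z'.
Proof.
case=> phi [phi_br phi_i phi_p].
have [zl zr zchi] := zP; have [zl' zr' zchi'] := zP'.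
have [q qP] := section_retraction sP'.
have map_phi_i (x : vpoly nat H) : map_coef i' x = map_coef phi (map_coef i x).
  rewrite (map_coef_comp _ (linD phi) (linD i)); congr map_coef.
  by apply/funext => h; exact/esym/phi_i.
(* The difference of sections s' - φ∘s, read in H; [q] kills s', whence the sign. *)
pose beta : {linear R -> H} := \- (q \o (phi \o s)).
have betaE a : i' (beta a) = s' a - phi (s a).
  by rewrite /beta /= linearN qP phi_p sP opprB.
have i'I := map_coef_inj (J := nat) (linD i') (@ext_inj_inj _ _ _ E').
have map_l a h : map_coef i' (cl z a h) = br (phi (s a)) (i' h).
  by rewrite map_phi_i zl phi_br phi_i.
have map_r a h : map_coef i' (cr z a h) = flip (br (i' h) (phi (s a))).
  by rewrite map_phi_i zr -/(flip _) map_flip phi_br phi_i.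
have map_beta x : map_coef i' (map_coef beta x)
    = map_coef s' x - map_coef phi (map_coef s x).
  rewrite (map_coef_comp _ (linD i') (linD beta)) (map_coef_comp _ (linD phi) (linD s)).
  rewrite -(map_coef_subf _ (linD s') (addm_comp (linD phi) (linD s))).
  by congr map_coef; apply/funext => a /=; rewrite betaE.
exists beta; split=> [a h|a h|a b]; apply: i'I.
- by rewrite mapB zl' map_l ext_inj_hom betaE brBl.
- rewrite mapB zr' map_r -/(flip _) -/(flip _) map_flip ext_inj_hom betaE brBr.
  by rewrite (addmB (@flipD _ _)).
- rewrite -/(flip _) !(mapB, mapD) zchi' map_l map_flip map_r flipK map_beta.
  rewrite map_phi_i zchi mapB phi_br ext_inj_hom !betaE !brBl !brBr.
  have Z (A : zmodType) (x0 x1 x2 x3 u v : A) :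
    x3 - v = x0 - u + (x1 - x0) + (x2 - x0) - (v - u) + (x3 - x2 - (x1 - x0)).
    by zmodule.
  exact: Z.
Qed.

(** Subtracting β from s' gives a section of E' whose cocycle is z itself; matching the two
    splittings then preserves brackets. *)
Lemma equiv_extension_of_cocycle : equiv_cocycle z z' -> equiv_extension E E'.
Proof.
case=> beta [beta_l beta_r beta_chi].
have [zl zr zchi] := zP; have [zl' zr' zchi'] := zP'.
have [q qP] := section_retraction sP.
(* The section of E' that s must be sent to, so that [phi] takes s(a) + h to t(a) + h. *)
pose t : {linear R -> E'} := s' \- (i' \o beta).
have tE a : t a = s' a - i' (beta a) by [].
pose phi : {linear E -> E'} := (i' \o q) \+ (t \o p).
have phiE x : phi x = i' (q x) + t (p x) by [].
have q_i h : q (i h) = h.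
  by apply: (@ext_inj_inj _ _ _ E); rewrite qP proj_inj linear0 subr0.
have q_s a : q (s a) = 0.
  by apply: (@ext_inj_inj _ _ _ E); rewrite qP sP subrr linear0.
have phi_i h : phi (i h) = i' h by rewrite phiE q_i proj_inj linear0 addr0.
have phi_s a : phi (s a) = t a by rewrite phiE q_s sP linear0 add0r.
have map_i (x : vpoly nat H) : map_coef phi (map_coef i x) = map_coef i' x.
  rewrite (map_coef_comp _ (linD phi) (linD i)); congr map_coef.
  by apply/funext => h; exact: phi_i.
have map_s (x : vpoly nat R) : map_coef phi (map_coef s x)
    = map_coef s' x - map_coef i' (map_coef beta x).
  rewrite (map_coef_comp _ (linD phi) (linD s)) (map_coef_comp _ (linD i') (linD beta)).
  rewrite -(map_coef_subf _ (linD s') (addm_comp (linD i') (linD beta))).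
  by congr map_coef; apply/funext => a; exact: phi_s.
have map_l a h : map_coef i' (cl z a h) = br (t a) (i' h).
  have -> : cl z a h = cl z' a h - br (beta a) h by rewrite -beta_l opprB addrC subrK.
  by rewrite mapB zl' ext_inj_hom tE brBl.
have map_r a h : map_coef i' (flip (cr z a h)) = br (i' h) (t a).
  have -> : cr z a h = cr z' a h - flip (br h (beta a)).
    by rewrite /flip -beta_r opprB addrC subrK.
  rewrite (addmB (@flipD _ _)) flipK mapB map_flip zr' -/(flip _) flipK.
  by rewrite ext_inj_hom tE brBr.
(* The only one of the four kinds of products that involves the relation between χ and χ'; the other
   three follow from those for l and r and from the bracket of H. *)
have brss a b : map_coef phi (br (s a) (s b)) = br (t a) (t b).
  have -> : br (s a) (s b) = map_coef i (cchi z a b) + map_coef s (br a b).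
    by rewrite zchi subrK.
  rewrite mapD map_i map_s.
  have := congr1 (map_coef i') (beta_chi a b); rewrite -/(flip _) !(mapB, mapD).
  rewrite zchi' map_l map_r ext_inj_hom !tE !brBl !brBr.
  (* The premise is the relation giving χ' from χ; it is solved for [w], the image of χ(a,b), before
     the bracket of t(a) and t(b) is expanded. *)
  have Z (A : zmodType) (x0 x1 x2 x3 u v w : A) :
    x0 - u = w + (x1 - x3) + (x2 - x3) - v + x3 -> w + (u - v) = x0 - x1 - (x2 - x3).
    move=> h; have -> : w = (x0 - u) - (x1 - x3) - (x2 - x3) + v - x3.
      by rewrite h; zmodule.
    by zmodule.
  by apply: Z.
exists phi; split=> [x y| |x] //; last first.
  by rewrite phiE tE linearD linearB /= !proj_inj sP' add0r subr0.
have dec u : u = s (p u) + i (q u) by rewrite qP addrC subrK.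
rewrite (dec x) (dec y).
move: (p x) (q x) (p y) (q y) => a h b k.
rewrite (linD phi (s a)) (linD phi (s b)) !phi_i !phi_s (brDD (s a)) (brDD (t a)) 3!mapD.
have -> : map_coef phi (br (s a) (i k)) = br (t a) (i' k) by rewrite -zl map_i map_l.
have -> : map_coef phi (br (i h) (s b)) = br (i' h) (t b).
  by rewrite -map_r -map_i map_flip zr -/(flip _) flipK.
have -> : map_coef phi (br (i h) (i k)) = br (i' h) (i' k).
  by rewrite -ext_inj_hom map_i ext_inj_hom.
by rewrite brss.
Qed.

End Equivalence.

(** * Equivalence classes and the bijection *)

Section Classes.
Variables (T : Type) (e : T -> T -> Prop).
Hypotheses (e_refl : forall x, e x x) (e_sym : forall x y, e x y -> e y x).
Hypothesis e_trans : forall x y t, e x y -> e y t -> e x t.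

Lemma class_ofP x y : class_of e x = class_of e y <-> e x y.
Proof.
split=> [exy|xy].
  by have := congr1 (fun C : classes e => sval C) exy; rewrite /= => ->.
apply: eq_exist; apply/funext => t; apply/propext; split; last exact: e_trans.
by apply: e_trans; exact: e_sym.
Qed.

Lemma class_of_surj (C : classes e) : exists x, class_of e x = C.
Proof. by case: C => P [x Px]; exists x; apply: eq_exist. Qed.

End Classes.

Section Classification.
Variables (K : fieldType) (R H : leibniz_conformal K).

Lemma split_cocycle (E : split_extension R H) :
  exists (s : {linear R -> E}) (z : nab_cocycle R H),
    is_section s /\ cocycle_of_section s z.
Proof.
by have [s sP] := split_section E; have [z zP] := section_cocycle sP; exists s, z.
Qed.

Lemma equiv_extension_refl (E : split_extension R H) : equiv_extension E E.
Proof.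
by exists idfun; split=> // a b; exact: map_coef_id.
Qed.

Lemma equiv_extension_trans (E1 E2 E3 : split_extension R H) :
  equiv_extension E1 E2 -> equiv_extension E2 E3 -> equiv_extension E1 E3.
Proof.
move=> [f [f_br f_i f_p]] [g [g_br g_i g_p]].
exists (g \o f); split=> [a b|h|x].
- by rewrite -[RHS]g_br -f_br (map_coef_comp _ (addm_linear g) (addm_linear f)).
- exact: etrans (congr1 g (f_i h)) (g_i h).
- exact: etrans (g_p _) (f_p x).
Qed.

(** The short five lemma makes f bijective; its inverse preserves brackets because this can be
    tested after applying the injective f. *)
Lemma equiv_extension_sym (E1 E2 : split_extension R H) :
  equiv_extension E1 E2 -> equiv_extension E2 E1.
Proof.
move=> [f [f_br f_i f_p]].
have [s sP] := split_section E1.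
have fsP : is_section (f \o s : {linear R -> E2}) by move=> a /=; rewrite f_p sP.
(* For the section f∘s of [E2], an element y is the sum of q(y) and f(s(p y)); the inverse of f
   keeps q(y) in H and replaces f∘s by s. *)
have [q qP] := section_retraction fsP.
pose g : {linear E2 -> E1} := (ext_inj E1 \o q) \+ (s \o ext_proj E2).
have gE x : g x = ext_inj E1 (q x) + s (ext_proj E2 x) by [].
have f_inj : injective f.
  apply: raddf_inj => x fx0.
  have /ext_exact [h xh] : ext_proj E1 x = 0 by rewrite -f_p fx0 linear0.
  have h0 : ext_inj E2 h = ext_inj E2 0 by rewrite -f_i -xh fx0 linear0.
  by rewrite xh (ext_inj_inj h0) linear0.
have fg x : f (g x) = x by rewrite gE linearD f_i qP /= subrK.
exists g; split=> [x y|h|x].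
- apply: (map_coef_inj (addm_linear f) f_inj); rewrite f_br !fg.
  rewrite (map_coef_comp _ (addm_linear f) (addm_linear g)).
  by rewrite (_ : f \o g = id) ?map_coef_id //; exact/funext.
- by apply: f_inj; rewrite fg f_i.
- by rewrite -f_p fg.
Qed.

(** With E' = E and the identity map, it contains the independence of the class from the section. *)
Lemma equiv_extension_cocycleP (E E' : split_extension R H) (s : {linear R -> E})
    (s' : {linear R -> E'}) (z z' : nab_cocycle R H) :
  is_section s -> is_section s' -> cocycle_of_section s z -> cocycle_of_section s' z' ->
  equiv_extension E E' <-> equiv_cocycle z z'.
Proof.
move=> sP sP' zP zP'; split.
  exact: (equiv_cocycle_of_extension sP sP' zP zP').
exact: (equiv_extension_of_cocycle sP sP' zP zP').
Qed.

Lemma prod_sec_section (z : nab_cocycle R H) :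
  @is_section K R H (prod_split_extension z) (prod_sec H : {linear R -> _}).
Proof. by []. Qed.

Lemma prod_equivP (z z' : nab_cocycle R H) :
  equiv_extension (prod_split_extension z) (prod_split_extension z')
  <-> equiv_cocycle z z'.
Proof.
exact: (equiv_extension_cocycleP (@prod_sec_section z) (@prod_sec_section z')
          (prod_cocycle z) (prod_cocycle z')).
Qed.

Lemma extension_classP (E E' : split_extension R H) :
  class_of (@equiv_extension K R H) E = class_of (@equiv_extension K R H) E'
  <-> equiv_extension E E'.
Proof.
apply: class_ofP; [exact: equiv_extension_refl|exact: equiv_extension_sym|].
exact: equiv_extension_trans.
Qed.

(** That cocycle equivalence is reflexive, symmetric and transitive is read off from the product
    extensions by [prod_equivP], with no manipulation of β. *)
Lemma cocycle_classP (z z' : nab_cocycle R H) :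
  class_of (@equiv_cocycle K R H) z = class_of (@equiv_cocycle K R H) z'
  <-> equiv_cocycle z z'.
Proof.
apply: class_ofP => [x|x y|x y t].
- exact/prod_equivP/equiv_extension_refl.
- by move=> /prod_equivP xy; apply/prod_equivP/equiv_extension_sym.
- move=> /prod_equivP xy /prod_equivP yt; apply/prod_equivP.
  exact: equiv_extension_trans xy yt.
Qed.

Lemma classification :
  exists Phi : extension_classes R H -> H2nab R H,
    bijective Phi /\
    forall (E : split_extension R H) (s : {linear R -> E}) (z : nab_cocycle R H),
      is_section s -> cocycle_of_section s z ->
      Phi (class_of (@equiv_extension _ R H) E)
      = class_of (@equiv_cocycle _ R H) z.
Proof.
pose classE := class_of (@equiv_extension K R H).
pose classz := class_of (@equiv_cocycle K R H).
(* The value is required to fit every representative, section and cocycle at once, so the function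
   chosen satisfies the stated formula without a separate proof of well-definedness. *)
have /choice [Phi PhiP] (C : extension_classes R H) : exists D : H2nab R H,
    forall (E : split_extension R H) (s : {linear R -> E}) z,
      classE E = C -> is_section s -> cocycle_of_section s z -> D = classz z.
  have [E0 <-] := class_of_surj C; have [s0 [z0 [sP0 zP0]]] := split_cocycle E0.
  exists (classz z0) => E s z /extension_classP EE0 sP zP.
  apply/cocycle_classP/(equiv_extension_cocycleP sP0 sP zP0 zP).
  exact: equiv_extension_sym.
(* The inverse: the product extension of some representative. Both cancellations compare a cocycle
   with that of the section [prod_sec]. *)
have /choice [Psi PsiP] (D : H2nab R H) : exists C : extension_classes R H,
    exists2 z, D = classz z & C = classE (prod_split_extension z).
  have [z <-] := class_of_surj D.
  by exists (classE (prod_split_extension z)), z.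
exists Phi; split; last by move=> E s z; exact: PhiP.
exists Psi => [C|D].
- have [E EC] := class_of_surj C; have [s [z [sP zP]]] := split_cocycle E.
  have [z1] := PsiP (Phi C); rewrite (PhiP C E s z EC sP zP) => /cocycle_classP zz1 ->.
  rewrite -EC; apply/extension_classP/equiv_extension_sym.
  exact/(equiv_extension_cocycleP sP (@prod_sec_section z1) zP (prod_cocycle z1)).
- have [z -> ->] := PsiP D.
  exact: (PhiP _ _ _ _ erefl (@prod_sec_section z) (prod_cocycle z)).
Qed.

End Classification.

(** [T[i]] is the field of complex numbers. The first part ensures that the formula for [Phi]
    reaches every section of every extension considered, since each section has a cocycle. *)
Theorem proposition3p5 (T : realType) (R H : leibniz_conformal (T[i])) :
  (forall (E : split_extension R H) (s : {linear R -> E}), is_section s ->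
     exists z : nab_cocycle R H, cocycle_of_section s z) /\
  exists Phi : extension_classes R H -> H2nab R H,
    bijective Phi /\
    forall (E : split_extension R H) (s : {linear R -> E}) (z : nab_cocycle R H),
      is_section s -> cocycle_of_section s z ->
      Phi (class_of (@equiv_extension _ R H) E)
      = class_of (@equiv_cocycle _ R H) z.
Proof.
by split; [move=> E s sP; exact: section_cocycle|exact: classification].
Qed.
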